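(* (a) For every integer $n \ge 3$, $\left\lfloor \frac{n+7}{6} \right\rfloor \le \sigma^2_3(K_n) \le \left\lceil \frac{n}{4} \right\rceil$. (b) For all integers $1 \le p \le q$, $\frac{pq}{2p+2q-4} \le \sigma^2_3(K_{p,q}) \le p$ (where the lower bound is asserted only for $(p,q)\neq(1,1)$, when its denominator is nonzero); and if additionally $q > p(p-1)$, then $\sigma^2_3(K_{p,q}) = \lceil p/2 \rceil$.
   Context: Graphs are finite and simple. $K_n$ is the complete graph on $n$ vertices and $K_{p,q}$ the complete bipartite graph with parts of sizes $p$ and $q$. A circular-arc drawing of a graph $G$ in $\mathbb{R}^d$ represents the vertices by distinct points and each edge by a circular arc (a proper sub-arc of a circle) connecting the points of its endvertices; it is crossing-free if no edge passes through a vertex other than its endpoints and any two edges are disjoint except possibly at common endpoints. For integers $1\le l<d$, the spherical cover number $\sigma^l_d(G)$ is the minimum number of $l$-dimensional spheres in $\mathbb{R}^d$ (so a $1$-dimensional sphere is a circle, and a $2$-dimensional sphere is an ordinary sphere) such that $G$ has a crossing-free circular-arc drawing in $\mathbb{R}^d$ that is contained in the union of these spheres. *)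

(* Defs.v *)
From HB Require Import structures.
From mathcomp Require Export all_boot all_order all_algebra.
From mathcomp Require Export boolp classical_sets reals trigo.

Set Implicit Arguments.
Unset Strict Implicit.
Unset Printing Implicit Defensive.
Import Order.TTheory GRing.Theory Num.Theory.
Local Open Scope classical_set_scope.
Local Open Scope ring_scope.

Record graph := Graph {
  vertex :> finType;
  adj : rel vertex;
  adj_sym : symmetric adj;
  adj_irrefl : irreflexive adj }.

Definition edges (G : graph) : {set {set G}} :=
  [set e : {set G} | [exists u, exists v, adj u v && (e == [set u; v]%SET)]]%SET.

Section CompleteGraph.
Variable n : nat.
Definition complete_adj : rel 'I_n := [rel i j | i != j].
Lemma complete_adj_sym : symmetric complete_adj.
Proof. by move=> i j; rewrite /complete_adj /= eq_sym. Qed.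
Lemma complete_adj_irrefl : irreflexive complete_adj.
Proof. by move=> i; rewrite /complete_adj /= eqxx. Qed.
Definition complete_graph := Graph complete_adj_sym complete_adj_irrefl.
End CompleteGraph.

Section CompleteBipartiteGraph.
Variables p q : nat.
Definition is_left (x : 'I_p + 'I_q) : bool := if x is inl _ then true else false.
Definition bipartite_adj : rel ('I_p + 'I_q) :=
  [rel x y | is_left x != is_left y].
Lemma bipartite_adj_sym : symmetric bipartite_adj.
Proof. by move=> x y; rewrite /bipartite_adj /= eq_sym. Qed.
Lemma bipartite_adj_irrefl : irreflexive bipartite_adj.
Proof. by move=> x; rewrite /bipartite_adj /= eqxx. Qed.
Definition complete_bipartite_graph := Graph bipartite_adj_sym bipartite_adj_irrefl.
End CompleteBipartiteGraph.

Section Drawings.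
Variable R : realType.

(* The library norm on 'rV[R]_d is the sup norm, hence these definitions. *)
Definition dot d (x y : 'rV[R]_d) : R := \sum_(i < d) x 0 i * y 0 i.
Definition enorm d (x : 'rV[R]_d) : R := Num.sqrt (dot x x).

(* An l-dimensional sphere is the set of points at distance r > 0 from c in
   an (l+1)-dimensional affine subspace through c; the direction of that
   subspace is the row space of W. *)
Definition is_sphere l d (S : set 'rV[R]_d) : Prop :=
  exists (c : 'rV[R]_d) (r : R) (W : 'M[R]_(l.+1, d)),
    [/\ 0 < r, row_free W &
        S = [set x | (x - c <= W)%MS /\ enorm (x - c) = r]].

Definition circle_point d (c e1 e2 : 'rV[R]_d) (r t : R) : 'rV[R]_d :=
  c + (r * cos t) *: e1 + (r * sin t) *: e2.

(* A closed proper sub-arc, of angle 0 < theta < 2 * pi, of the circle with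
   centre c and radius r in the plane through c spanned by the orthonormal
   pair e1, e2; the frame is chosen so that the arc starts at angle 0. *)
Definition is_circular_arc d (x y : 'rV[R]_d) (A : set 'rV[R]_d) : Prop :=
  exists (c e1 e2 : 'rV[R]_d) (r theta : R),
    [/\ [/\ dot e1 e1 = 1, dot e2 e2 = 1 & dot e1 e2 = 0],
        0 < r, 0 < theta < 2 * pi,
        x = circle_point c e1 e2 r 0 /\ y = circle_point c e1 e2 r theta &
        A = [set circle_point c e1 e2 r t | t in [set t : R | 0 <= t <= theta]]].

(* The values of arc outside the edges of G are irrelevant. *)
Record drawing d (G : graph) := Drawing {
  pos : G -> 'rV[R]_d;
  arc : {set G} -> set 'rV[R]_d;
  pos_inj : injective pos;
  arcP : forall u v : G, adj u v ->
    is_circular_arc (pos u) (pos v) (arc [set u; v]%SET) }.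

Definition crossing_free d G (D : drawing d G) : Prop :=
  (forall (e : {set G}) (w : G), e \in edges G -> arc D e (pos D w) -> w \in e)
  /\
  (forall (e f : {set G}) (x : 'rV[R]_d), e \in edges G -> f \in edges G ->
     e != f -> arc D e x -> arc D f x ->
     exists w : G, [/\ w \in e, w \in f & x = pos D w]).

Definition drawn_in d G (D : drawing d G) (X : set 'rV[R]_d) : Prop :=
  (forall v : G, X (pos D v)) /\
  (forall e : {set G}, e \in edges G -> arc D e `<=` X).

(* The spheres of the family may coincide; this does not affect the minimum
   below. *)
Definition coverable l d (G : graph) (k : nat) : Prop :=
  exists S : 'I_k -> set 'rV[R]_d,
    (forall i, is_sphere l (S i)) /\
    exists D : drawing d G,
      crossing_free D /\ drawn_in D (\bigcup_(i in [set: 'I_k]) S i).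

(* sigma^l_d(G) = s, with the minimum attained. *)
Definition spherical_cover_number l d (G : graph) (s : nat) : Prop :=
  coverable l d G s /\ forall k : nat, coverable l d G k -> (s <= k)%N.

End Drawings.

(* Main.v *)
(** The lower bounds come from Euler's formula on each sphere: a sphere carries
    at most [3 |V| - 6] edges, and at most [2 |V| - 4] if the graph is bipartite.
    Stereographic projection from a generic point turns the arcs on one sphere
    into plane arcs, for which Euler's formula is proved over F_2 without the
    Jordan curve theorem. Each arc, closed up by vertical downward rays from its
    ends, shades a region; the vector of these shades at a point, modulo the cut
    space, is locally constant off the drawing and changes by the coordinate
    functional of [e] across an edge [e]. It takes [F > dim (cycle space)]
    values on the two sides of the edges that lie on cycles, and since the
    boundary of every value is an even edge set, each value is taken on at least
    girth many edge sides, while there are only [2 |E|] edge sides.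

    For the upper bounds, all spheres pass through a common unit circle. For
    [K_{p,q}] the [q] vertices are on the circle and the [p] vertices are poles
    of the spheres, joined to the circle by meridians. For [K_n] the vertices
    are on the circle and the two caps of each sphere are pages of a book
    embedding with [ceil (n / 2)] pages. *)
Require Import Defs.
From mathcomp Require Import all_boot all_order all_algebra reals.
From mathcomp Require Import ring lra zify.
From mathcomp Require Import boolp classical_sets topology normedtype trigo.
Set Implicit Arguments.
Unset Strict Implicit.
Unset Printing Implicit Defensive.
Import Order.TTheory GRing.Theory Num.Theory.
Import numFieldNormedType.Exports.
Local Open Scope classical_set_scope.
Local Open Scope ring_scope.



(** * Euler's bound over F_2 *)

(** An arc covered by [k] spheres lies on one of them: among [2k + 1] of its points three lie on a
    common sphere, and along a circle the squared distance to a centre is affine in cosine and sine,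
    so three points decide. This is what splits the edges into sets to which Euler's bound applies
    sphere by sphere.

    The rays dictate the rest of the setting. Crossing the ray below a vertex flips the shades of
    exactly the edges ending there, which is a cut; hence the quotient by cuts. A ray must miss all
    other vertices, so besides a projection point off the planes of all arcs a generic horizontal
    direction is needed, giving the vertices distinct abscissae. An edge set without cycles yields
    no face to count, hence the alternative [m <= n] in the bounds.

    For the drawings of complete graphs, a cap bounded by the common circle is projected onto the
    unit disc from the opposite pole of its sphere. The arcs are chosen in planes through that pole,
    so they project to straight chords, and crossing on a page becomes crossing of chords. *)

(* [B] is the edge-vertex incidence matrix and [L e] the class of the points on
   one side of [e]; the class on the other side is [L e + col e (kermx B)]. *)
Definition face_boundary m n (B : 'M['F_2]_(m, n)) (L : 'I_m -> 'cV['F_2]_m)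
    (f : 'cV['F_2]_m) : 'rV['F_2]_m :=
  \row_e ((L e == f)%:R + (L e + col e (kermx B) == f)%:R).

(** The all-ones vector, killed because an edge has two ends, costs one rank among the [n.+1]
    vertices; rank-nullity turns this into many cycles. *)
Lemma rank_kermx_incidence m n (B : 'M['F_2]_(m, n.+1)) :
  B *m const_mx 1 = 0 :> 'cV_m -> (m - n <= \rank (kermx B))%N.
Proof.
move=> B1; rewrite mxrank_ker leq_sub2l //.
have := mulmx0_rank_max B1.
have -> : \rank (const_mx 1 : 'cV['F_2]_n.+1) = 1%N.
  apply/eqP; rewrite eqn_leq rank_leq_col lt0n mxrank_eq0.
  by apply/eqP => /matrixP /(_ ord0 ord0); rewrite !mxE.
by rewrite addn1 ltnS.
Qed.

Lemma face_count m n g (B : 'M['F_2]_(m, n.+1)) (L : 'I_m -> 'cV['F_2]_m) :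
  B *m const_mx 1 = 0 :> 'cV_m ->
  (forall z : 'rV_m, z != 0 -> z *m B = 0 -> (g <= #|[set e | z 0%R e != 0%R]%SET|)%N) ->
  (forall f, face_boundary B L f *m B = 0) ->
  (m <= n)%N \/ (g * (m - n).+1 <= 2 * m)%N.
Proof.
move=> B1 girth Leven.
have rK := rank_kermx_incidence B1.
set K := kermx B in rK *.
(* The edges form a forest when there are no cycles. *)
have [K0|K0] := eqVneq K 0.
  by left; move: rK; rewrite K0 mxrank0 leqn0 subn_eq0.
right.
pose F := [set f | face_boundary B L f != 0]%SET.
have F2b (a b : bool) : (a%:R + b%:R != 0 :> 'F_2) = a (+) b.
  by case: a; case: b.
have Fcol e : col e K != 0 -> L e \in F /\ L e + col e K \in F.
  move=> Ke; have LK : L e != L e + col e K.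
    by rewrite -subr_eq0 opprD addNKr oppr_eq0.
  split; rewrite inE; apply/eqP => /matrixP /(_ 0 e) /eqP; rewrite !mxE;
    by apply/negP; rewrite F2b eqxx 1?[_ + _ == L e]eq_sym (negPf LK).
have [e0 Ke0] : exists e, col e K != 0.
  apply/existsP; apply: contraNT K0; rewrite negb_exists => /forallP H.
  apply/eqP/matrixP => i j; move/(_ j): H; rewrite negbK => /eqP/matrixP/(_ i 0).
  by rewrite !mxE.
have [f0F _] := Fcol _ Ke0; set f0 := L e0 in f0F.
(* A nonzero column of [K] is the difference of the two classes beside its edge, and both belong to
   [F]. So the translates [f - f0], for the members [f] of [F] other than [f0], span all columns. *)
have rF : (\rank K <= #|F|.-1)%N.
  rewrite -mxrank_tr.
  pose W := (\sum_(f in F :\ f0) <<(f - f0)^T>>)%MS.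
  have sub (f : 'cV['F_2]_m) : f \in F -> ((f - f0)^T <= W)%MS.
    move=> fF; have [->|ne] := eqVneq f f0; first by rewrite subrr trmx0 sub0mx.
    rewrite -(genmxE (f - f0)^T); apply: (sumsmx_sup f) => //.
    by rewrite !inE ne; move: fF; rewrite inE.
  have KW : (K^T <= W)%MS.
    apply/row_subP => e; rewrite -tr_col.
    have [->|Ke] := eqVneq (col e K) 0; first by rewrite trmx0 sub0mx.
    have [/sub s1 /sub s2] := Fcol _ Ke.
    have -> : (col e K)^T = (L e + col e K - f0)^T - (L e - f0)^T.
      by rewrite -raddfB opprB addrA subrK addrAC subrr add0r.
    by rewrite addmx_sub // eqmx_opp.
  apply: (leq_trans (mxrankS KW)).
  apply: (leq_trans (mxrank_sum_leqif _)).
  rewrite (cardsD1 f0 F) f0F /= -sum1_card.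
  by apply: leq_sum => f _; rewrite genmxE rank_leq_row.
have F0 : (0 < #|F|)%N by rewrite (cardD1 f0) f0F.
have mF : ((m - n).+1 <= #|F|)%N.
  by rewrite -(prednK F0) ltnS (leq_trans rK).
apply: (@leq_trans (g * #|F|)); first by rewrite leq_mul2l mF orbT.
pose supp f := [set e | face_boundary B L f 0 e != 0]%SET.
apply: (@leq_trans (\sum_(f in F) #|supp f|)%N).
  rewrite mulnC -sum_nat_const; apply: leq_sum => f; rewrite inE => fF.
  exact: girth.
under eq_bigr => f _ do rewrite -sum1_card.
rewrite (exchange_big_dep xpredT) //=.
rewrite mulnC -[X in (_ <= X * _)%N]card_ord -sum_nat_const; apply: leq_sum => e _.
rewrite sum1_card; apply: (@leq_trans #|[set L e; L e + col e K]%SET|); last first.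
  by rewrite cards2; case: (_ != _).
apply: subset_leq_card; apply/fintype.subsetP => f; rewrite !inE => /andP[_].
rewrite !inE mxE F2b ![f == _]eq_sym -/K.
by case: (L e == f); case: (_ == f).
Qed.

(** * Plane drawings *)

Lemma connected_locally_constant (T : topologicalType) (U : Type) (A : set T)
    (h : T -> U) : connected A ->
  (forall x, A x -> \forall y \near x, A y -> h y = h x) ->
  forall x y, A x -> A y -> h x = h y.
Proof.
move=> cA loc x y Ax Ay.
suff E : A `&` [set z | h z = h x] = A by have [_ ->] : (A `&` [set z | h z = h x]) y by rewrite E.
apply: cA; first by exists x.
- exists [set z | A z -> h z = h x]^°; first exact: open_interior.
  apply/seteqP; split=> z [Az hz]; split=> //.
    by move: (loc z Az); apply: filterS => w hw Aw; rewrite hw.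
  exact: (nbhs_singleton hz).
- exists (~` [set z | A z -> h z <> h x]^°).
    by apply: open_closedC; exact: open_interior.
  apply/seteqP; split=> z [Az hz]; split=> //.
    by move=> /nbhs_singleton /(_ Az).
  apply: contrapT => hzx; apply: hz.
  by move: (loc z Az); apply: filterS => w hw Aw; rewrite hw.
Qed.

Section Plane.
Variable R : realType.
Implicit Types (x y u v w : R * R) (f g : R * R -> R).

Lemma near_gt0 f x : {for x, continuous f} -> 0 < f x -> \forall y \near x, 0 < f y.
Proof. by move=> cf; exact: (@cvgr_gt _ _ _ _ f (f x) cf 0). Qed.

Lemma near_lt0 f x : {for x, continuous f} -> f x < 0 -> \forall y \near x, f y < 0.
Proof. by move=> cf; exact: (@cvgr_lt _ _ _ _ f (f x) cf 0). Qed.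

Lemma near_lt_const f g x : {for x, continuous f} -> {for x, continuous g} ->
  f x != g x -> \forall y \near x, (f y < g y) = (f x < g x).
Proof.
move=> cf cg; have cfg : {for x, continuous (f \- g)} by exact: continuousB.
rewrite neq_lt => /orP[] h.
  have : (f \- g) x < 0 by rewrite /= subr_lt0.
  by move/(near_lt0 cfg); apply: filterS => y; rewrite /= subr_lt0 => ->.
have : 0 < (f \- g) x by rewrite /= subr_gt0.
move/(near_gt0 cfg); apply: filterS => y; rewrite /= subr_gt0 => hy.
by rewrite !ltNge !ltW.
Qed.

Lemma near_le_const f g x : {for x, continuous f} -> {for x, continuous g} ->
  f x != g x -> \forall y \near x, (f y <= g y) = (f x <= g x).
Proof.
move=> cf cg; rewrite eq_sym => h; have := near_lt_const cg cf h.
by apply: filterS => y hy; rewrite !leNgt hy.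
Qed.

Lemma fst_continuous : continuous (@fst R R).
Proof. by move=> x; exact: cvg_fst. Qed.

Lemma pair_continuous (T : topologicalType) (p q : T -> R) t :
  {for t, continuous p} -> {for t, continuous q} ->
  {for t, continuous (fun s => (p s, q s) : R * R)}.
Proof.
move=> cp cq.
exact: (@cvg_pair _ _ _ (nbhs t) (nbhs (p t)) (nbhs (q t)) _ _ _ p q cp cq).
Qed.

Definition turn u v y : R := (v.1 - u.1) * (y.2 - u.2) - (v.2 - u.2) * (y.1 - u.1).

Lemma turn_continuous u v : continuous (turn u v).
Proof.
move=> x; rewrite /turn; apply: cvgB; apply: cvgM; (try exact: cvg_cst);
  (apply: cvgB; last exact: cvg_cst); [exact: cvg_snd | exact: cvg_fst].
Qed.
End Plane.

Lemma pair_ext (S T : Type) (p q : S * T) : p.1 = q.1 -> p.2 = q.2 -> p = q.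
Proof. by case: p q => [a b] [c d] /= -> ->. Qed.

Section ChordalArc.
Variable R : realType.

(* The arc is the part of the zero set of [curve] on one side of its chord, and
   [curve < 0] is the inside of the curve. *)
Record chordal_arc := ChordalArc {
  left_end : R * R;
  right_end : R * R;
  curve : R * R -> R;
  above : bool }.

Implicit Types (a : chordal_arc) (x y w : R * R).

Definition chord_turn a := turn (left_end a) (right_end a).

Definition on_arc a y : bool :=
  (curve a y == 0) && (if above a then 0 <= chord_turn a y else chord_turn a y <= 0).

Definition in_arc a y : bool :=
  (curve a y == 0) && (if above a then 0 < chord_turn a y else chord_turn a y < 0).

(** Restricted to the chord line, the equation of a circle is a quadratic in [t] with its roots at
    the two ends. Positivity of [k] puts the open chord, and no other part of that line, inside the
    curve. *)
Definition arc_wf a : Prop :=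
  [/\ (left_end a).1 < (right_end a).1, continuous (curve a) &
      exists2 k, 0 < k & forall t,
        curve a (left_end a + t *: (right_end a - left_end a)) = k * (t * (t - 1))].

Definition right_of w y : bool := w.1 <= y.1.
Definition beneath w y : bool := (y.1 == w.1) && (y.2 < w.2).
Definition inside a y : bool := curve a y < 0.

(* The region below the chord, modified by the segment between arc and chord:
   it is bounded by the arc and the vertical downward rays from its ends. *)
Definition shade a y : bool :=
  ((right_of (left_end a) y (+) right_of (right_end a) y) && (chord_turn a y < 0))
  (+) (inside a y && ((chord_turn a y < 0) (+) above a)).

Lemma on_chord_line a y : arc_wf a -> chord_turn a y = 0 ->
  exists t, y = left_end a + t *: (right_end a - left_end a).
Proof.
move=> [lt _ _]; rewrite /chord_turn /turn.
case: (left_end a) lt => u1 u2; case: (right_end a) => v1 v2; case: y => y1 y2 /= lt H.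
have d0 : v1 - u1 != 0 by rewrite subr_eq0 gt_eqF.
have E : (v2 - u2) * (y1 - u1) = (v1 - u1) * (y2 - u2) by lra.
exists ((y1 - u1) / (v1 - u1)); apply: pair_ext => /=.
  by change (y1 = u1 + (y1 - u1) / (v1 - u1) * (v1 - u1)); field.
change (y2 = u2 + (y1 - u1) / (v1 - u1) * (v2 - u2)).
by rewrite mulrAC [_ * (v2 - u2)]mulrC E; field.
Qed.

Lemma on_arcE a y : arc_wf a -> on_arc a y ->
  [\/ in_arc a y, y = left_end a | y = right_end a].
Proof.
move=> wf /andP[/eqP c0 h]; have [t0|tn0] := eqVneq (chord_turn a y) 0; last first.
  by constructor 1; rewrite /in_arc c0 eqxx; case: (above a) h => h;
    rewrite lt_neqAle ?tn0 1?eq_sym ?tn0.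
have [t yE] := on_chord_line wf t0; case: wf => _ _ [k k0 kE].
have : k * (t * (t - 1)) = 0 by rewrite -kE -yE.
move/eqP; rewrite mulf_eq0 gt_eqF //= mulf_eq0 => /orP[] /eqP t01.
  by constructor 2; rewrite yE t01 scale0r addr0.
by constructor 3; rewrite yE (subr0_eq t01) scale1r addrC subrK.
Qed.

(** The indicator [right_of w] jumps across the whole vertical line through [w]. The factor [b],
    which on this line tells whether [x] is under [w], leaves only the jump across the downward
    ray. *)
Lemma near_right_of w x b : x != w -> (x.1 == w.1 -> b = (x.2 < w.2)) ->
  exists C : bool, \forall y \near x,
    right_of w y && b = C (+) (right_of w y && beneath w x).
Proof.
move=> xw; rewrite /beneath; have [e ->//|ne _] := eqVneq x.1 w.1.
  by exists false; apply: filterE => y.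
exists (right_of w x && b).
have := @near_le_const _ (fun=> w.1) fst x (@cst_continuous _ _ _ _) (@fst_continuous _ _).
rewrite eq_sym => /(_ ne); apply: filterS => y; rewrite /right_of => ->.
by rewrite andbF addbF.
Qed.

(** Across the chord line the two terms of [shade] change only along the open chord, and there they
    change together and cancel. The verticals through the ends survive only below the ends, and the
    curve only on the side of the chord line that carries the arc. *)
Lemma near_shade a x : arc_wf a -> x != left_end a -> x != right_end a ->
  exists C : bool, \forall y \near x,
    shade a y = C (+) (right_of (left_end a) y && beneath (left_end a) x)
                  (+) (right_of (right_end a) y && beneath (right_end a) x)
                  (+) (on_arc a x && inside a y).
Proof.
move=> wf xu xv; have [lt cc [k k0 kE]] := wf.
have ct : continuous (chord_turn a) by exact: turn_continuous.
have near_inside : curve a x != 0 -> \forall y \near x, inside a y = inside a x.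
  by move=> c0; exact: (near_lt_const (cc x) (@cst_continuous _ _ 0 x) c0).
have [t0|tn0] := eqVneq (chord_turn a x) 0.
  have [t xE] := on_chord_line wf t0.
  have t_0 : t != 0 by apply: contraNneq xu => e; rewrite xE e scale0r addr0.
  have t_1 : t != 1 by apply: contraNneq xv => e; rewrite xE e scale1r addrC subrK.
  have cx : curve a x = k * (t * (t - 1)) by rewrite xE kE.
  have cx0 : curve a x != 0 by rewrite cx !mulf_eq0 !negb_or subr_eq0 t_0 t_1 gt_eqF.
  have x1 : x.1 = (left_end a).1 + t * ((right_end a).1 - (left_end a).1) by rewrite xE.
  have xu1 : (left_end a).1 != x.1.
    by rewrite x1 eq_sym -subr_eq0 addrAC subrr add0r mulf_eq0 negb_or t_0 subr_eq0 gt_eqF.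
  have xv1 : (right_end a).1 != x.1.
    apply/eqP => e; have : (t - 1) * ((right_end a).1 - (left_end a).1) = 0 by lra.
    by apply/eqP; rewrite mulf_eq0 negb_or !subr_eq0 t_1 gt_eqF.
  have bu : beneath (left_end a) x = false by rewrite /beneath eq_sym (negPf xu1).
  have bv : beneath (right_end a) x = false by rewrite /beneath eq_sym (negPf xv1).
  have onx : on_arc a x = false by rewrite /on_arc (negPf cx0).
  have nu := near_le_const (@cst_continuous _ _ _ x) (@fst_continuous _ x) xu1.
  have nv := near_le_const (@cst_continuous _ _ _ x) (@fst_continuous _ x) xv1.
  exists (inside a x && above a).
  near=> y.
  rewrite bu bv onx !andbF !addbF /shade.
  have -> : inside a y = inside a x by near: y; exact: near_inside.
  have -> : right_of (left_end a) y = right_of (left_end a) x by near: y; exact: nu.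
  have -> : right_of (right_end a) y = right_of (right_end a) x by near: y; exact: nv.
  (* Lying between the verticals and lying inside the curve both mean [0 < t < 1] on the chord
     line. *)
  suff -> : right_of (left_end a) x (+) right_of (right_end a) x = inside a x.
    by case: (inside a x); case: (_ < 0) => //; case: (above a).
  rewrite /inside cx pmulr_rlt0 // /right_of.
  have lt0 : 0 < (right_end a).1 - (left_end a).1 by rewrite subr_gt0.
  have [tneg|tpos] := ltP t 0.
    have -> : ((left_end a).1 <= x.1) = false.
      by apply/negbTE; rewrite -ltNge x1; nra.
    have -> : ((right_end a).1 <= x.1) = false.
      by apply/negbTE; rewrite -ltNge x1; nra.
    by apply/esym/negbTE; rewrite -leNgt; nra.
  have -> : ((left_end a).1 <= x.1) = true by rewrite x1; nra.
  have [tl|tg] := ltP t 1.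
    have -> : ((right_end a).1 <= x.1) = false.
      by apply/negbTE; rewrite -ltNge x1; nra.
    have tp : 0 < t by rewrite lt_def t_0.
    by rewrite pmulr_rlt0 // subr_lt0 tl.
  have -> : ((right_end a).1 <= x.1) = true.
    have : 0 <= (t - 1) * ((right_end a).1 - (left_end a).1) by apply: mulr_ge0; [rewrite subr_ge0 | exact: ltW].
    by rewrite x1 => h; apply/idP; lra.
  by apply/esym/negbTE; rewrite -leNgt mulr_ge0 // subr_ge0.
set b := chord_turn a x < 0.
have nb : \forall y \near x, (chord_turn a y < 0) = b.
  exact: (near_lt_const (ct x) (@cst_continuous _ _ 0 x) tn0).
have lt0 : 0 < (right_end a).1 - (left_end a).1 by rewrite subr_gt0.
have [Cu hu] : exists C : bool, \forall y \near x,
    right_of (left_end a) y && b = C (+) (right_of (left_end a) y && beneath (left_end a) x).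
  apply: near_right_of => // /eqP e; rewrite /b /chord_turn /turn e subrr mulr0 subr0.
  by rewrite pmulr_rlt0 // subr_lt0.
have [Cv hv] : exists C : bool, \forall y \near x,
    right_of (right_end a) y && b = C (+) (right_of (right_end a) y && beneath (right_end a) x).
  apply: near_right_of => // /eqP e; rewrite /b /chord_turn /turn e.
  set p := _ - _ in lt0 *; rewrite (_ : _ - _ = p * (x.2 - (right_end a).2)); last by ring.
  by rewrite pmulr_rlt0 // subr_lt0.
have [C hC] : exists C : bool, \forall y \near x,
    inside a y && (b (+) above a) = C (+) (on_arc a x && inside a y).
  have [c0|cn0] := eqVneq (curve a x) 0; last first.
    exists (inside a x && (b (+) above a)); move: (near_inside cn0).
    by apply: filterS => y ->; rewrite /on_arc (negPf cn0) addbF.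
  (* With [x] on the curve and off the chord line, [b (+) above a] says precisely that [x] is on the
     arc. *)
  exists false; apply: filterE => y; rewrite /on_arc c0 eqxx /= /b.
  by case: (above a); rewrite ?addbT ?addbF -?leNgt andbC //= lt_neqAle tn0.
exists (C (+) Cu (+) Cv).
apply: filter_app nb; apply: filter_app hC; apply: filter_app hv; apply: filter_app hu.
apply: filterE => y eu ev eC eb.
rewrite /shade eb andb_addl eu ev eC.
case: (_ && beneath (left_end a) x); case: (_ && beneath (right_end a) x);
  by case: (on_arc a x && _); case: C {eC} => //; case: Cu {eu} => //; case: Cv {ev}.
Unshelve. all: by end_near.
Qed.
End ChordalArc.

Lemma near_not_on_arc (R : realType) (a : chordal_arc R) x :
  arc_wf a -> ~~ on_arc a x -> \forall y \near x, ~~ on_arc a y.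
Proof.
move=> [_ cc _]; rewrite negb_and => /orP[c0|t0].
  move: c0; rewrite neq_lt => /orP[] c0.
    by move: (near_lt0 (cc x) c0); apply: filterS => y; rewrite /on_arc => /lt_eqF ->.
  by move: (near_gt0 (cc x) c0); apply: filterS => y; rewrite /on_arc => /gt_eqF ->.
have ct : {for x, continuous (chord_turn a)} by exact: turn_continuous.
have : \forall y \near x, ~~ (if above a then 0 <= chord_turn a y else chord_turn a y <= 0).
  case: (above a) t0; rewrite -ltNge => t0.
    by move: (near_lt0 ct t0); apply: filterS => y; rewrite ltNge.
  by move: (near_gt0 ct t0); apply: filterS => y; rewrite ltNge.
by apply: filterS => y h; rewrite negb_and h orbT.
Qed.

Lemma addb_F2 (a b : bool) : (a (+) b)%:R = a%:R + b%:R :> 'F_2.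
Proof. by case: a; case: b; apply/val_inj. Qed.

Lemma andb_addb2 (j s r z : bool) :
  j && (s (+) (r (+) z)) = (j && s) (+) ((j && r) (+) (j && z)).
Proof. by case: j. Qed.

Lemma sumb_F2 (I : finType) (P : pred I) (F : I -> bool) :
  (\big[addb/false]_(i | P i) F i)%:R = \sum_(i | P i) (F i)%:R :> 'F_2.
Proof. by apply: (big_morph (fun b : bool => b%:R : 'F_2) addb_F2). Qed.

(** * Cells of a plane drawing and the evenness of their boundaries *)

Section PlaneDrawing.
Variables (R : realType) (m n : nat).
Variables (pos : 'I_n -> R * R) (src tgt : 'I_m -> 'I_n) (a : 'I_m -> chordal_arc R).
Variable pt : 'I_m -> R * R.

Definition incident w e := (w == src e) || (w == tgt e).
(** Only the edges on one sphere are kept, so a vertex without such an edge may lie off the sphere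
    and has no meaningful projection. The geometric hypotheses on vertices are therefore restricted
    to these. *)
Definition touched w := [exists e, incident w e].

Definition incidence : 'M['F_2]_(m, n) := \matrix_(e, w) (incident w e)%:R.

(** Left multiplication by the kernel matrix realises the quotient by cuts, which are the vectors
    [incidence *m T]. *)
Definition cell y : 'cV['F_2]_m :=
  kermx incidence *m \col_e (shade (a e) y)%:R.

(** On the arc itself [inside] is false, so this is the class on the side where [curve] is
    nonnegative. *)
Definition side e := cell (pt e).

Hypothesis wf : forall e, arc_wf (a e).
Hypothesis srcE : forall e, left_end (a e) = pos (src e).
Hypothesis tgtE : forall e, right_end (a e) = pos (tgt e).
Hypothesis pos_inj : forall w w', touched w -> touched w' ->
  (pos w).1 = (pos w').1 -> w = w'.
Hypothesis disjoint_arcs : forall e f y, e != f -> on_arc (a e) y -> on_arc (a f) y ->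
  exists w, [/\ y = pos w, incident w e & incident w f].
Hypothesis avoid : forall e w, touched w -> on_arc (a e) (pos w) -> incident w e.
Hypothesis arc_connected : forall e, connected [set y | in_arc (a e) y].
Hypothesis in_arc_pt : forall e, in_arc (a e) (pt e).

Let K := kermx incidence.

Lemma incident_touched w e : incident w e -> touched w.
Proof. by move=> h; apply/existsP; exists e. Qed.

Lemma src_touched e : touched (src e).
Proof. by apply: (@incident_touched _ e); rewrite /incident eqxx. Qed.

Lemma tgt_touched e : touched (tgt e).
Proof. by apply: (@incident_touched _ e); rewrite /incident eqxx orbT. Qed.

Lemma src_neq_tgt e : src e != tgt e.
Proof.
have [lt _ _] := wf e; apply/eqP => E.
by move: lt; rewrite srcE tgtE E ltxx.
Qed.

Lemma sum_incident (t : 'I_n -> 'F_2) e :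
  \sum_w (incident w e)%:R * t w = t (src e) + t (tgt e).
Proof.
rewrite (bigD1 (src e)) //= (bigD1 (tgt e)) 1?eq_sym ?src_neq_tgt //=.
rewrite /incident !eqxx orbT !mul1r big1 ?addr0 // => w /andP[/negPf -> /negPf ->].
by rewrite mul0r.
Qed.

Lemma incidence1 : incidence *m const_mx 1 = 0 :> 'cV_m.
Proof.
apply/matrixP => e j; rewrite !mxE.
under eq_bigr => w _ do rewrite !mxE.
by rewrite (sum_incident (fun=> 1)); apply/val_inj.
Qed.

Lemma in_arc_neq_pos e x w : in_arc (a e) x -> touched w -> x != pos w.
Proof.
move=> inx tw; apply/eqP => E.
have onx : on_arc (a e) x.
  by move: inx; rewrite /in_arc /on_arc => /andP[-> /=]; case: (above _) => /ltW.
move: onx inx; rewrite E => /(avoid tw) /orP[] /eqP ->; rewrite /in_arc /chord_turn.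
  by rewrite -srcE /turn !subrr !mulr0 subrr !ltxx; case: above; rewrite andbF.
by rewrite -tgtE /turn mulrC subrr !ltxx; case: above; rewrite andbF.
Qed.

Lemma in_on_arc e x : in_arc (a e) x -> on_arc (a e) x.
Proof. by rewrite /in_arc /on_arc => /andP[-> /=]; case: (above _) => /ltW. Qed.

Lemma on_in_arc e x : (forall w, touched w -> x != pos w) ->
  on_arc (a e) x -> in_arc (a e) x.
Proof.
move=> xN /(on_arcE (wf e)) [//| |] E.
  by have := xN _ (src_touched e); rewrite -srcE E eqxx.
by have := xN _ (tgt_touched e); rewrite -tgtE E eqxx.
Qed.

Lemma on_arc_unique x e f : (forall w, touched w -> x != pos w) ->
  on_arc (a e) x -> on_arc (a f) x -> e = f.
Proof.
move=> xN xe xf; apply: contrapT => /eqP ef.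
have [w [E we _]] := disjoint_arcs ef xe xf.
by have := xN w (incident_touched we); rewrite E eqxx.
Qed.

Lemma near_shades x : (forall w, touched w -> x != pos w) ->
  \forall y \near x, forall e, shade (a e) y = shade (a e) x
    (+) ((right_of (pos (src e)) y (+) right_of (pos (src e)) x) && beneath (pos (src e)) x)
    (+) ((right_of (pos (tgt e)) y (+) right_of (pos (tgt e)) x) && beneath (pos (tgt e)) x)
    (+) (on_arc (a e) x && inside (a e) y).
Proof.
move=> xN; pose P (e : 'I_m) : set (R * R) := [set y | shade (a e) y = shade (a e) x
    (+) ((right_of (pos (src e)) y (+) right_of (pos (src e)) x) && beneath (pos (src e)) x)
    (+) ((right_of (pos (tgt e)) y (+) right_of (pos (tgt e)) x) && beneath (pos (tgt e)) x)
    (+) (on_arc (a e) x && inside (a e) y)].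
apply: (@filter_forall _ _ P (nbhs x)) => e; rewrite /P /=.
have := near_shade (wf e); rewrite srcE tgtE.
move=> /(_ x (xN _ (src_touched e)) (xN _ (tgt_touched e))) [C hC].
have /= hx := @nbhs_singleton _ _ _ hC.
have onF : on_arc (a e) x && inside (a e) x = false.
  by rewrite /on_arc /inside; case: eqP => //= ->; rewrite ltxx andbF.
rewrite /= onF addbF in hx.
move: hC; apply: filterS => y /= hy; rewrite hy hx !andb_addl.
move: (right_of (pos (src e)) y && _) (right_of (pos (tgt e)) y && _).
move: (right_of (pos (src e)) x && _) (right_of (pos (tgt e)) x && _) (_ && _).
by case: C {hx hy} => [] [] [] [] [] [].
Qed.

Lemma ker_incidence : K *m incidence = 0.
Proof. exact: mulmx_ker. Qed.

(** The change of the shades caused by the rays is [incidence *m T], where [T] marks the vertices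
    whose ray is crossed; [K] kills it. Only the change across an arc through [x] is left. *)
Lemma near_cell x : (forall w, touched w -> x != pos w) ->
  \forall y \near x, cell y = cell x + K *m \col_e (on_arc (a e) x && inside (a e) y)%:R.
Proof.
move=> xN; move: (near_shades xN); apply: filterS => y hy.
pose t w : 'F_2 := ((right_of (pos w) y (+) right_of (pos w) x) && beneath (pos w) x)%:R.
pose X : 'cV['F_2]_m := \col_e (shade (a e) x)%:R.
pose Z : 'cV['F_2]_m := \col_e (on_arc (a e) x && inside (a e) y)%:R.
pose T : 'cV['F_2]_n := \col_w t w.
have E : \col_e (shade (a e) y)%:R = X + Z + incidence *m T :> 'cV['F_2]_m.
  apply/matrixP => e j; rewrite !mxE.
  under eq_bigr => w _ do rewrite !mxE.
  rewrite (sum_incident t e) hy /t.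
  by move: (shade (a e) x) => s; rewrite !addb_F2 -(addrA s%:R) addrAC.
by rewrite /cell E -/X -/Z -/K !mulmxDr mulmxA ker_incidence mul0mx addr0.
Qed.

Lemma near_cell_free x : (forall w, touched w -> x != pos w) ->
  (forall e, ~~ on_arc (a e) x) -> \forall y \near x, cell y = cell x.
Proof.
move=> xN xA; move: (near_cell xN); apply: filterS => y ->.
rewrite (_ : \col_e _ = 0) ?mulmx0 ?addr0 //.
by apply/matrixP => e j; rewrite !mxE (negPf (xA e)).
Qed.

Lemma near_cell_arc x e : (forall w, touched w -> x != pos w) ->
  on_arc (a e) x ->
  \forall y \near x, cell y = if inside (a e) y then cell x + col e K else cell x.
Proof.
move=> xN xe; move: (near_cell xN); apply: filterS => y ->.
rewrite (_ : \col_f _ = (inside (a e) y)%:R *: delta_mx e 0).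
  rewrite -scalemxAr -colE; case: (inside _ _); last by rewrite scale0r addr0.
  by rewrite scale1r.
apply/matrixP => f j; rewrite !mxE (ord1 j) andbT.
have [->|fe] := eqVneq f e; first by rewrite xe mulr1.
rewrite mulr0; case xf : (on_arc (a f) x) => //.
by rewrite (on_arc_unique xN xf xe) eqxx in fe.
Qed.

Lemma cell_side e x : (forall w, touched w -> x != pos w) ->
  on_arc (a e) x -> cell x = side e.
Proof.
move=> xN xe.
apply: (connected_locally_constant (@arc_connected e)); [|exact: on_in_arc|exact: in_arc_pt].
move=> z /= ze; have zN w := in_arc_neq_pos ze (w := w).
move: (near_cell_arc zN (in_on_arc ze)); apply: filterS => y -> /andP[/eqP c0 _].
by rewrite /inside c0 ltxx.
Qed.


Lemma near_vertex v : touched v -> \forall y \near pos v,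
  (forall e, ~~ incident v e -> ~~ on_arc (a e) y) /\
  (forall w, touched w -> w != v -> y.1 != (pos w).1).
Proof.
move=> tv.
pose P (e : 'I_m) : set (R * R) := [set y | ~~ incident v e -> ~~ on_arc (a e) y].
pose Q (w : 'I_n) : set (R * R) := [set y | touched w -> w != v -> y.1 != (pos w).1].
have hP : \forall y \near pos v, forall e, P e y.
  apply: (@filter_forall _ _ P (nbhs (pos v))) => e.
  have [ive|ive] := boolP (incident v e).
    by apply: filterE => y; rewrite /P /= ive.
  have : ~~ on_arc (a e) (pos v) by apply: contra ive; exact: avoid.
  by move/(near_not_on_arc (wf e)); apply: filterS => y h _.
have hQ : \forall y \near pos v, forall w, Q w y.
  apply: (@filter_forall _ _ Q (nbhs (pos v))) => w.
  have [tw|tw] := boolP (touched w); last by apply: filterE => y; rewrite /Q /= (negPf tw).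
  have [->|wv] := eqVneq w v; first by apply: filterE => y; rewrite /Q /= eqxx.
  have ne : (pos w).1 != (pos v).1.
    by apply/eqP => /(pos_inj tw tv) E; rewrite E eqxx in wv.
  have cw : {for pos v, continuous (fun=> (pos w).1 : R)} by exact: cst_continuous.
  have cv := @fst_continuous R (pos v).
  have := near_lt_const cw cv ne; apply: filter_app.
  have := near_lt_const cv cw; rewrite eq_sym => /(_ ne); apply: filterS => y h1 h2 _ _.
  by rewrite neq_lt h1 h2 -neq_lt eq_sym.
by apply: filter_app hP; apply: filterS hQ.
Qed.

Definition jump f e : bool := (side e == f) (+) (side e + col e K == f).

Definition jumps f v : bool := \big[addb/false]_(e | incident v e) jump f e.

(* Around [v], the shades cancel the jumps of [cell y == f] across the arcs
   ending at [v]; the only jump left is at the ray below [v]. *)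
Definition tracker f v y : bool :=
  (cell y == f) (+) \big[addb/false]_(e | incident v e) (jump f e && shade (a e) y).

(** At most one arc passes through [x], and it ends at [v]. Crossing it changes [cell y == f] and
    the summand of that arc both by [jump f e]. As [x] is on no vertical through another vertex, the
    only ray in reach is the one below [v], and it flips the shades of all edges at [v] at once. *)
Lemma near_tracker f v x : x != pos v -> touched v ->
  (forall e, ~~ incident v e -> ~~ on_arc (a e) x) ->
  (forall w, touched w -> w != v -> x.1 != (pos w).1) ->
  \forall y \near x, tracker f v y = tracker f v x (+)
    (jumps f v && ((right_of (pos v) y (+) right_of (pos v) x) && beneath (pos v) x)).
Proof.
move=> xv tv xA xw.
have xN w : touched w -> x != pos w.
  move=> tw; have [->//|wv] := eqVneq w v.
  by apply: contraNneq (xw w tw wv) => ->.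
pose S y := \big[addb/false]_(e | incident v e) (jump f e && (on_arc (a e) x && inside (a e) y)).
have hcell : \forall y \near x, (cell y == f) = (cell x == f) (+) S y.
  have [/existsP[e xe]|] := boolP [exists e, on_arc (a e) x]; last first.
    rewrite negb_exists => /forallP noarc; have := near_cell_free xN noarc.
    apply: filterS => y ->; rewrite /S big1 ?addbF // => e _.
    by rewrite (negPf (noarc e)) andbF.
  have ive : incident v e by apply: contraLR xe; exact: xA.
  have := near_cell_arc xN xe; apply: filterS => y ->.
  rewrite /S (bigD1 e) //= xe /= big1 ?addbF => [|g /andP[_ ge]]; last first.
    case xg : (on_arc (a g) x); last by rewrite andbF.
    by rewrite (on_arc_unique xN xg xe) eqxx in ge.
  rewrite /jump (cell_side xN xe).
  by case: (inside _ _); rewrite ?andbT ?andbF ?addbF // addKb.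
apply: filter_app hcell; have := near_shades xN; apply: filterS => y hy hcell.
pose r := (right_of (pos v) y (+) right_of (pos v) x) && beneath (pos v) x.
rewrite -/r /tracker hcell -!addbA; congr (_ (+) _).
under eq_bigr => e ive.
  have -> : shade (a e) y = shade (a e) x (+) (r (+) (on_arc (a e) x && inside (a e) y)).
    have offv w : touched w -> w != v -> beneath (pos w) x = false.
      by move=> tw wv; rewrite /beneath (negPf (xw w tw wv)).
    rewrite hy /r; case/orP: (ive) => /eqP E.
      have := offv _ (tgt_touched e); rewrite E eq_sym src_neq_tgt => -> //.
      by rewrite andbF addbF addbA.
    have := offv _ (src_touched e); rewrite E src_neq_tgt => -> //.
    by rewrite andbF addbF addbA.
  rewrite andb_addb2; over.
rewrite !big_split /= -big_distrl /= -/(S y) -/(jumps f v) addbC -addbA; congr (_ (+) _).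
by rewrite addbK.
Qed.

Lemma tracker_path f v (g : R -> R * R) (r s : R) : touched v -> continuous g -> r <= s ->
  (forall t, r <= t <= s -> [/\ g t != pos v,
     forall e, ~~ incident v e -> ~~ on_arc (a e) (g t) &
     forall w, touched w -> w != v -> (g t).1 != (pos w).1]) ->
  (forall t t', r <= t <= s -> r <= t' <= s -> beneath (pos v) (g t) ->
     right_of (pos v) (g t') = right_of (pos v) (g t)) ->
  tracker f v (g r) = tracker f v (g s).
Proof.
move=> tv cg rs hg hb.
pose h t := tracker f v (g t).
apply: (connected_locally_constant (h := h) (@segment_connected R r s)); last 2 first.
- by rewrite /= in_itv /= lexx rs.
- by rewrite /= in_itv /= lexx rs.
move=> t /=; rewrite in_itv /= => tI.
have [h1 h2 h3] := hg t tI.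
have H : \forall t' \near t, tracker f v (g t') = tracker f v (g t) (+) (jumps f v &&
    ((right_of (pos v) (g t') (+) right_of (pos v) (g t)) && beneath (pos v) (g t))).
  exact: (cg t _ (near_tracker f h1 tv h2 h3)).
apply: filterS H => t'; rewrite in_itv /= => ht' t'I.
rewrite /h ht'; case bt: (beneath _ _); last by rewrite !andbF addbF.
by rewrite (hb t t') // addbb andbF addbF.
Qed.

(** The tracker is followed along a small square around [v]: from the point on the ray below [v] to
    the right, around over the top, and back to the ray from the left. It never changes on the way,
    whereas crossing the ray itself would change it by [jumps f v]. *)
Lemma jumps_even f v : touched v -> jumps f v = false.
Proof.
move=> tv; have /nbhs_ballP [d /= d0 hd] := near_vertex tv.
pose c := d / 2; have c0 : 0 < c by rewrite divr_gt0.
pose p t s : R * R := ((pos v).1 + t, (pos v).2 + s).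
have pneq t s : (t != 0) || (s != 0) -> p t s != pos v.
  apply: contraTneq => E; rewrite negb_or !negbK.
  have E1 : (p t s).1 = (pos v).1 by rewrite E.
  have E2 : (p t s).2 = (pos v).2 by rewrite E.
  by apply/andP; split; apply/eqP; rewrite /= in E1 E2; lra.
have good t s : - c <= t <= c -> - c <= s <= c -> (t != 0) || (s != 0) ->
    [/\ p t s != pos v, forall e, ~~ incident v e -> ~~ on_arc (a e) (p t s) &
        forall w, touched w -> w != v -> (p t s).1 != (pos w).1].
  move=> /andP[t1 t2] /andP[s1 s2] ts; have [] := hd (p t s); last by split=> //; exact: pneq.
  by split; rewrite /ball /= opprD addNKr normrN ltr_norml; apply/andP; split; rewrite /c in t1 t2 s1 s2 *; lra.
have hcont s : continuous (fun t => p t s).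
  move=> t; apply: pair_continuous; last exact: cvg_cst.
  by apply: cvgD; [exact: cvg_cst | exact: cvg_id].
have vcont t : continuous (fun s => p t s).
  move=> s; apply: (@pair_continuous _ _ (fun=> (pos v).1 + t) (fun s => (pos v).2 + s)); first exact: cvg_cst.
  by apply: cvgD; [exact: cvg_cst | exact: cvg_id].
have rightE t s : right_of (pos v) (p t s) = (0 <= t) by rewrite /right_of /= lerDl.
have beneathE t s : beneath (pos v) (p t s) = (t == 0) && (s < 0).
  by rewrite /beneath /= gtrDl -[X in _ == X]addr0 (inj_eq (addrI _)).
have cN : c != 0 by rewrite gt_eqF.
have cN' : - c != 0 by rewrite oppr_eq0.
have T1 : tracker f v (p 0 (- c)) = tracker f v (p c (- c)).
  apply: (@tracker_path f v (fun t => p t (- c))) => //; first exact: ltW.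
    by move=> t /andP[t1 t2]; apply: good; rewrite ?cN' ?orbT //; lra.
  by move=> t t' /andP[t1 _] /andP[t1' _] _; rewrite !rightE t1 t1'.
have T2 : tracker f v (p c (- c)) = tracker f v (p c c).
  apply: (@tracker_path f v (fun s => p c s)) => //; first by lra.
  by move=> t tI; apply: good; rewrite ?cN //; lra.
have T3 : tracker f v (p (- c) c) = tracker f v (p c c).
  apply: (@tracker_path f v (fun t => p t c)) => //; first by lra.
    by move=> t tI; apply: good; rewrite ?cN ?orbT //; lra.
  by move=> t t' _ _; rewrite beneathE ltNge ltW // andbF.
have T4 : tracker f v (p (- c) (- c)) = tracker f v (p (- c) c).
  apply: (@tracker_path f v (fun s => p (- c) s)) => //; first by lra.
  by move=> t tI; apply: good; rewrite ?cN' //; lra.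
have [h1 h2 h3] : [/\ p 0 (- c) != pos v,
    forall e, ~~ incident v e -> ~~ on_arc (a e) (p 0 (- c)) &
    forall w, touched w -> w != v -> (p 0 (- c)).1 != (pos w).1].
  by apply: good; rewrite ?cN' ?orbT //; lra.
have : \forall t \near (0 : R), tracker f v (p t (- c)) = tracker f v (p 0 (- c)) (+)
    (jumps f v && ((right_of (pos v) (p t (- c)) (+) right_of (pos v) (p 0 (- c)))
       && beneath (pos v) (p 0 (- c)))).
  exact: (hcont (- c) 0 _ (near_tracker f h1 tv h2 h3)).
move=> /nbhs_ballP [e /= e0 he].
pose t := - (Num.min e c / 2).
have m0 : 0 < Num.min e c by rewrite lt_min e0.
have me : Num.min e c <= e by rewrite ge_min lexx.
have mc : Num.min e c <= c by rewrite ge_min lexx orbT.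
have t0 : t < 0 by rewrite /t; lra.
have T5 : tracker f v (p (- c) (- c)) = tracker f v (p t (- c)).
  apply: (@tracker_path f v (fun t => p t (- c))) => //; first by rewrite /t; lra.
    by move=> t' /andP[t1 t2]; apply: good; rewrite ?cN' ?orbT //; lra.
  move=> t' t'' /andP[_ t1] /andP[_ t2] _; rewrite !rightE.
  by rewrite !leNgt (le_lt_trans t1 t0) (le_lt_trans t2 t0).
have := he t; rewrite /ball /= sub0r normrN ltr_norml => /(_ _).
rewrite !rightE beneathE eqxx lexx oppr_lt0 c0 (leNgt 0 t) t0 /= andbT.
have -> : - e < t < e by rewrite /t; apply/andP; split; lra.
move=> /(_ isT); rewrite -T5 T4 T3 -T2 -T1.
by case: (tracker _ _ _); case: (jumps f v).
Qed.

Theorem cell_boundary_even f : face_boundary incidence side f *m incidence = 0.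
Proof.
apply/matrixP => i v; rewrite !mxE.
under eq_bigr => e _ do rewrite !mxE.
have [tv|ntv] := boolP (touched v); last first.
  rewrite big1 // => e _; case: (boolP (incident v e)) => [/incident_touched|_].
    by rewrite (negPf ntv).
  by rewrite mulr0.
have := congr1 (fun b : bool => b%:R : 'F_2) (jumps_even f tv).
rewrite sumb_F2; apply: etrans; rewrite [RHS]big_mkcond; apply: eq_bigr => e _.
by case: (incident v e); rewrite ?mulr0 // mulr1 /jump addb_F2.
Qed.

End PlaneDrawing.

(** * Circular arcs on a sphere *)

Section Vectors.
Variable R : realType.
Implicit Types (x y z a b : 'rV[R]_3) (k : R).

Definition i0 : 'I_3 := ord0.
Definition i1 : 'I_3 := Ordinal (isT : (1 < 3)%N).
Definition i2 : 'I_3 := Ordinal (isT : (2 < 3)%N).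

Definition vec3 (p q s : R) : 'rV[R]_3 := \row_i [:: p; q; s]`_i.

Lemma vec3E p q s : (vec3 p q s 0 i0 = p) * (vec3 p q s 0 i1 = q) * (vec3 p q s 0 i2 = s).
Proof. by rewrite !mxE. Qed.

Lemma vec3P x y : x 0 i0 = y 0 i0 -> x 0 i1 = y 0 i1 -> x 0 i2 = y 0 i2 -> x = y.
Proof.
move=> h0 h1 h2; apply/rowP => -[[|[|[|//]]] hi].
- by rewrite (_ : Ordinal hi = i0) //; exact/val_inj.
- by rewrite (_ : Ordinal hi = i1) //; exact/val_inj.
- by rewrite (_ : Ordinal hi = i2) //; exact/val_inj.
Qed.

Lemma dot3E x y : dot x y = x 0 i0 * y 0 i0 + x 0 i1 * y 0 i1 + x 0 i2 * y 0 i2.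
Proof.
rewrite /dot !big_ord_recr big_ord0 /= add0r.
by congr (_ * _ + _ * _ + _ * _); congr (_ 0 _); exact/val_inj.
Qed.

Lemma dotC x y : dot x y = dot y x.
Proof. by rewrite !dot3E; ring. Qed.

Lemma dotDr x y z : dot x (y + z) = dot x y + dot x z.
Proof. by rewrite !dot3E !mxE; ring. Qed.

Lemma dotDl x y z : dot (y + z) x = dot y x + dot z x.
Proof. by rewrite dotC dotDr !(dotC x). Qed.

Lemma dotZr k x y : dot x (k *: y) = k * dot x y.
Proof. by rewrite !dot3E !mxE; ring. Qed.

Lemma dotZl k x y : dot (k *: x) y = k * dot x y.
Proof. by rewrite dotC dotZr dotC. Qed.

Lemma dotNr x y : dot x (- y) = - dot x y.
Proof. by rewrite -scaleN1r dotZr mulN1r. Qed.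

Lemma dotNl x y : dot (- x) y = - dot x y.
Proof. by rewrite dotC dotNr dotC. Qed.

Lemma dotBr x y z : dot x (y - z) = dot x y - dot x z.
Proof. by rewrite dotDr dotNr. Qed.

Lemma dotBl x y z : dot (y - z) x = dot y x - dot z x.
Proof. by rewrite dotDl dotNl. Qed.

Lemma dot0r x : dot x 0 = 0.
Proof. by rewrite -(scale0r 0) dotZr mul0r. Qed.

Definition dotE := (dotDl, dotDr, dotNl, dotNr, dotZl, dotZr).

Lemma dot_ge0 x : 0 <= dot x x.
Proof. by rewrite dot3E -!expr2 !addr_ge0 ?sqr_ge0. Qed.

Lemma dot_eq0 x : (dot x x == 0) = (x == 0).
Proof.
apply/idP/eqP => [|->]; last by rewrite dot0r.
rewrite dot3E -!expr2 !paddr_eq0 ?addr_ge0 ?sqr_ge0 // !sqrf_eq0.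
by move=> /andP[/andP[/eqP h0 /eqP h1] /eqP h2]; apply: vec3P; rewrite mxE.
Qed.

Lemma dot_gt0 x : (0 < dot x x) = (x != 0).
Proof. by rewrite lt_def dot_ge0 andbT dot_eq0. Qed.

Definition cross x y := vec3 (x 0 i1 * y 0 i2 - x 0 i2 * y 0 i1)
  (x 0 i2 * y 0 i0 - x 0 i0 * y 0 i2) (x 0 i0 * y 0 i1 - x 0 i1 * y 0 i0).

Lemma dot_cross_cyc x y z : dot (cross x y) z = dot x (cross y z).
Proof. by rewrite !dot3E !vec3E; ring. Qed.

Lemma dot_crossl x y : dot x (cross x y) = 0.
Proof. by rewrite !dot3E !vec3E; ring. Qed.

Lemma dot_crossr x y : dot y (cross x y) = 0.
Proof. by rewrite !dot3E !vec3E; ring. Qed.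

Lemma dot_cross2 x y : dot (cross x y) (cross x y) = dot x x * dot y y - dot x y ^+ 2.
Proof. by rewrite !dot3E !vec3E; ring. Qed.

(** Cramer's rule in the frame [a], [b], [cross a b] with the denominator cleared, so that it is a
    polynomial identity. *)
Lemma cross_decomposition a b z : let n := cross a b in
  dot n n *: z = dot n z *: n + (dot b b * dot a z - dot a b * dot b z) *: a
    + (dot a a * dot b z - dot a b * dot a z) *: b.
Proof. by apply: vec3P; rewrite !mxE !dot3E !vec3E /=; ring. Qed.

Lemma orthonormal_decomposition a b z : dot a a = 1 -> dot b b = 1 -> dot a b = 0 ->
  z = dot (cross a b) z *: cross a b + dot a z *: a + dot b z *: b.
Proof.
move=> aa bb ab; have := cross_decomposition a b z.
by rewrite /= dot_cross2 aa bb ab !mul0r !subr0 expr0n subr0 !mul1r scale1r.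
Qed.

(** The product of the polynomials has fewer roots than its size [size q], so some natural number
    below [size q] is not a root. *)
Lemma poly_avoid (I : finType) (p : I -> {poly R}) :
  (forall i, p i != 0) -> exists t, forall i, (p i).[t] != 0.
Proof.
move=> p0; pose q := \prod_i p i.
have q0 : q != 0 by apply/prodf_neq0 => i _.
pose s : seq R := [seq i%:R | i <- iota 0 (size q)].
have : ~~ all (root q) s.
  apply/negP => rs; have := max_poly_roots q0 rs.
  rewrite map_inj_uniq ?iota_uniq; last by move=> i j /eqP; rewrite eqr_nat => /eqP.
  by rewrite size_map size_iota ltnn => /(_ isT).
move=> /allPn[t _ rt]; exists t => i.
move: rt; rewrite /root /q horner_prod => /prodf_neq0; exact.
Qed.
End Vectors.

Section CircularArcs.
Variable R : realType.
Implicit Types (x y z c : 'rV[R]_3) (A : set 'rV[R]_3).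

(** Eliminating the ordinate from the equations of a line and the unit circle leaves a quadratic in
    the abscissa with leading coefficient [p ^+ 2 + q ^+ 2]; three distinct roots force it to
    vanish. *)
Lemma circle_line3 (P p q a1 b1 a2 b2 a3 b3 : R) :
  a1 ^+ 2 + b1 ^+ 2 = 1 -> a2 ^+ 2 + b2 ^+ 2 = 1 -> a3 ^+ 2 + b3 ^+ 2 = 1 ->
  a1 != a2 -> a1 != a3 -> a2 != a3 ->
  P + p * a1 + q * b1 = 0 -> P + p * a2 + q * b2 = 0 -> P + p * a3 + q * b3 = 0 ->
  [/\ P = 0, p = 0 & q = 0].
Proof.
move=> c1 c2 c3 n12 n13 n23 e1 e2 e3.
have quad a b : a ^+ 2 + b ^+ 2 = 1 -> P + p * a + q * b = 0 ->
    (p ^+ 2 + q ^+ 2) * a ^+ 2 + 2 * p * P * a + (P ^+ 2 - q ^+ 2) = 0.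
  move=> c0 e; have qb : q * b = - (P + p * a) by lra.
  have : (q * b) ^+ 2 = (P + p * a) ^+ 2 by rewrite qb sqrrN.
  by rewrite exprMn (_ : b ^+ 2 = 1 - a ^+ 2); [move=> h; lra | lra].
have lin a b a' b' : a != a' -> a ^+ 2 + b ^+ 2 = 1 -> P + p * a + q * b = 0 ->
    a' ^+ 2 + b' ^+ 2 = 1 -> P + p * a' + q * b' = 0 ->
    (p ^+ 2 + q ^+ 2) * (a + a') + 2 * p * P = 0.
  move=> ne h1 h2 h3 h4; have q1 := quad _ _ h1 h2; have q2 := quad _ _ h3 h4.
  have : (a - a') * ((p ^+ 2 + q ^+ 2) * (a + a') + 2 * p * P) = 0 by lra.
  by move/eqP; rewrite mulf_eq0 subr_eq0 (negPf ne) => /eqP.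
have l12 := lin _ _ _ _ n12 c1 e1 c2 e2; have l13 := lin _ _ _ _ n13 c1 e1 c3 e3.
have : (p ^+ 2 + q ^+ 2) * (a2 - a3) = 0 by lra.
move/eqP; rewrite mulf_eq0 subr_eq0 (negPf n23) orbF paddr_eq0 ?sqr_ge0 // !sqrf_eq0.
by move=> /andP[/eqP p0 /eqP q0]; split=> //; rewrite p0 q0 in e1; lra.
Qed.

(** An arc of half-angle [h] centred at angle 0 is the part of the circle where the cosine is at
    least [cos h], even when it exceeds a half circle. The parameter is shifted by [h] to start at
    an end; [acos] sees only the upper half, hence the cases on the sign of [v]. *)
Lemma unit_circle_arc (h u v : R) : 0 < h < pi -> u ^+ 2 + v ^+ 2 = 1 -> cos h <= u ->
  exists t, [/\ 0 <= t <= h * 2, u = cos (t - h), v = sin (t - h) &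
    cos h < u -> 0 < t < h * 2].
Proof.
move=> /andP[h0 hpi] uv hu.
have u1 : -1 <= u <= 1.
  have := sqr_ge0 v => v0; apply/andP; split; nra.
have hI : h \in `[0, pi] by rewrite in_itv /= !ltW.
pose s := acos u.
have s0 : 0 <= s by exact: acos_ge0.
have spi : s <= pi by exact: acos_lepi.
have sI : s \in `[0, pi] by rewrite in_itv /= s0.
have cs : cos s = u by rewrite acosK // in_itv.
have sh : s <= h by rewrite leNgt -(ltr_cos hI sI) cs -leNgt.
have shlt : cos h < u -> s < h by rewrite -cs ltr_cos.
have ss : sin s ^+ 2 = v ^+ 2 by rewrite sin2cos2 cs; lra.
have sins0 : 0 <= sin s by apply: sin_ge0_pi; rewrite s0.
have [v0|v0] := leP 0 v.
  have E : sin s = v by apply/eqP; rewrite -(eqrXn2 (n := 2)) // ss.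
  exists (h + s); split; rewrite ?[h + s]addrC ?addrK //; first by apply/andP; split; lra.
  by move/shlt => lt; apply/andP; split; lra.
have E : sin s = - v.
  by apply/eqP; rewrite -(eqrXn2 (n := 2)) // ?oppr_ge0 ?ltW // ss sqrrN.
exists (h - s); rewrite (_ : h - s - h = - s); last by ring.
rewrite cosN sinN E opprK; split=> //; first by apply/andP; split; lra.
by move/shlt => lt; apply/andP; split; lra.
Qed.

Lemma cos_gt_arc (h t : R) : 0 < h < pi -> 0 < t < h * 2 -> cos h < cos (t - h).
Proof.
move=> /andP[h0 hpi] /andP[t0 t2].
have hI : h \in `[0, pi] by rewrite in_itv /= !ltW.
have nI : `|t - h| \in `[0, pi].
  by rewrite in_itv /= normr_ge0 /= ler_norml; apply/andP; split; lra.
by rewrite -(cos_norm (t - h)) (ltr_cos nI hI) ltr_norml; apply/andP; split; lra.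
Qed.

Definition on_sphere c r x := dot (x - c) (x - c) = r ^+ 2.

Lemma circle_point_dist c (r : R) d e1 e2 (s t : R) :
  dot e1 e1 = 1 -> dot e2 e2 = 1 -> dot e1 e2 = 0 ->
  dot (circle_point d e1 e2 s t - c) (circle_point d e1 e2 s t - c) =
  dot (d - c) (d - c) + s ^+ 2 + (2 * s * dot e1 (d - c)) * cos t
    + (2 * s * dot e2 (d - c)) * sin t.
Proof.
move=> h1 h2 h12; rewrite /circle_point.
have -> : d + (s * cos t) *: e1 + (s * sin t) *: e2 - c =
    (d - c) + (s * cos t) *: e1 + (s * sin t) *: e2 by rewrite [LHS]addrAC; congr (_ + _); rewrite addrAC.
move: (d - c) => w; rewrite !dotE (dotC e2 e1) (dotC w e1) (dotC w e2) h1 h2 h12.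
have := cos2Dsin2 t; move: (cos t) (sin t) => a b ab.
have -> : s ^+ 2 = s ^+ 2 * (a ^+ 2 + b ^+ 2) by rewrite ab mulr1.
by ring.
Qed.

Lemma three_cos (h : R) : 0 < h -> exists t1 t2 t3 : R,
  [/\ 0 <= t1 <= h, 0 <= t2 <= h & 0 <= t3 <= h] /\
  [/\ cos t1 != cos t2, cos t1 != cos t3 & cos t2 != cos t3].
Proof.
move=> h0; pose m := Num.min h pi / 2.
have pp := @pi_gt0 R.
have mp : 0 < Num.min h pi by rewrite lt_min h0.
have mh : Num.min h pi <= h by rewrite ge_min lexx.
have mpi : Num.min h pi <= pi by rewrite ge_min lexx orbT.
have m0 : 0 < m by rewrite /m; lra.
have I0 : (0 : R) \in `[0, pi] by rewrite in_itv /=; apply/andP; split; lra.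
have I1 : m \in `[0, pi] by rewrite in_itv /= /m; apply/andP; split; lra.
have I2 : m * 2 \in `[0, pi] by rewrite in_itv /= /m; apply/andP; split; lra.
exists 0, m, (m * 2); split; split; rewrite ?(inj_in_eq (@cos_inj R)) //;
  try (by rewrite /m; apply/andP; split; lra); by rewrite -subr_eq0; apply/eqP => E; lra.
Qed.

(** Along the arc the squared distance to [c] is affine in [cos t] and [sin t]; being constant at
    three parameters with distinct cosines, it has zero coefficients. *)
Lemma circle_in_sphere c (r : R) d e1 e2 (s h : R) :
  dot e1 e1 = 1 -> dot e2 e2 = 1 -> dot e1 e2 = 0 -> 0 < s -> 0 < h ->
  (forall t, 0 <= t <= h -> on_sphere c r (circle_point d e1 e2 s t)) ->
  [/\ dot e1 (d - c) = 0, dot e2 (d - c) = 0 & dot (d - c) (d - c) + s ^+ 2 = r ^+ 2].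
Proof.
move=> h1 h2 h12 s0 h0 onS.
have [t1 [t2 [t3 [[I1 I2 I3] [n1 n2 n3]]]]] := three_cos h0.
have eqn t : 0 <= t <= h -> dot (d - c) (d - c) + s ^+ 2 - r ^+ 2
    + (2 * s * dot e1 (d - c)) * cos t + (2 * s * dot e2 (d - c)) * sin t = 0.
  by move/onS; rewrite /on_sphere circle_point_dist // => E; lra.
have [E0 E1 E2] := circle_line3 (cos2Dsin2 t1) (cos2Dsin2 t2) (cos2Dsin2 t3) n1 n2 n3
  (eqn _ I1) (eqn _ I2) (eqn _ I3).
have s2 : 2 * s != 0 by rewrite mulf_neq0 ?gt_eqF.
split; last by lra.
- by move/eqP: E1; rewrite mulf_eq0 (negPf s2) => /eqP.
- by move/eqP: E2; rewrite mulf_eq0 (negPf s2) => /eqP.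
Qed.

(* An arc on a sphere is cut out of it by the plane [dot normal z = level] and
   the half-space [threshold <= dot dir z]; [path] runs through its interior. *)
Record arc_cut := ArcCut {
  normal : 'rV[R]_3;
  level : R;
  dir : 'rV[R]_3;
  threshold : R;
  path : R -> 'rV[R]_3;
  duration : R }.

Definition cuts c (r : R) x y A (d : arc_cut) : Prop :=
  [/\ normal d != 0, 0 < duration d &
      forall z, on_sphere c r z ->
        (A z <-> dot (normal d) z = level d /\ threshold d <= dot (dir d) z)] /\
  [/\ A x /\ dot (dir d) x = threshold d, A y /\ dot (dir d) y = threshold d,
      forall v, continuous (fun t => dot v (path d t)),
      forall t, 0 < t < duration d -> A (path d t) /\ threshold d < dot (dir d) (path d t) &
      forall z, A z -> threshold d < dot (dir d) z ->
        exists2 t, 0 < t < duration d & z = path d t].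

Lemma cuts_sym c (r : R) x y A d : cuts c r x y A d -> cuts c r y x A d.
Proof. by move=> [H [h1 h2 h3 h4 h5]]; split=> //; split. Qed.

Lemma arc_on_sphere c (r : R) x y A : is_circular_arc x y A ->
  (forall z, A z -> on_sphere c r z) -> exists d, cuts c r x y A d.
Proof.
move=> [d [e1 [e2 [s [th [[h1 h2 h12] s0 /andP[th0 th2] [xE yE] AE]]]]]] onS.
pose h := th / 2; have thE : th = h * 2 by rewrite /h; lra.
have hI : 0 < h < pi by rewrite /h; apply/andP; split; lra.
have [d1 d2 dr] : [/\ dot e1 (d - c) = 0, dot e2 (d - c) = 0 &
    dot (d - c) (d - c) + s ^+ 2 = r ^+ 2].
  apply: (circle_in_sphere (h := th)) => // t tI; apply: onS.
  by rewrite AE; exists t.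
(* [n] is the normal of the plane of the circle, and [w] points from its centre to the midpoint of
   the arc; both ends have the same component along [w]. *)
pose n := cross e1 e2; pose w := cos h *: e1 + sin h *: e2.
pose g := circle_point d e1 e2 s.
have n1 : dot n e1 = 0 by rewrite dotC dot_crossl.
have n2 : dot n e2 = 0 by rewrite dotC dot_crossr.
have gn t : dot n (g t) = dot n d by rewrite /g /circle_point !dotE n1 n2; lra.
have gw t : dot w (g t) = dot w d + s * cos (t - h).
  by rewrite cosB /g /w /circle_point !dotE h1 h2 (dotC e2 e1) h12; ring.
have Ag t : 0 <= t <= th -> A (g t) by move=> tI; rewrite AE; exists t.
exists (ArcCut n (dot n d) w (dot w d + s * cos h) g th).
have charA z : on_sphere c r z -> dot n z = dot n d -> dot w d + s * cos h <= dot w z ->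
    exists t, [/\ 0 <= t <= th, z = g t & dot w d + s * cos h < dot w z -> 0 < t < th].
  move=> onz nz wz.
  have zE := orthonormal_decomposition (z - d) h1 h2 h12.
  rewrite -/n [dot n _]dotBr nz subrr scale0r add0r in zE.
  set a := dot e1 _ in zE; set b := dot e2 _ in zE.
  have ab : a ^+ 2 + b ^+ 2 = s ^+ 2.
    have : dot (z - c) (z - c) = r ^+ 2 by [].
    have -> : z - c = (d - c) + a *: e1 + b *: e2.
      by rewrite -addrA -zE addrC subrKA.
    move: (d - c) d1 d2 dr => v d1 d2 dr.
    by rewrite !dotE (dotC v e1) (dotC v e2) d1 d2 (dotC e2 e1) h1 h2 h12; lra.
  have wzE : dot w z = dot w d + (cos h * a + sin h * b).
    have : dot w (z - d) = cos h * a + sin h * b by rewrite /w dotDl !dotZl.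
    by rewrite dotBr => E; lra.
  (* Cosine and sine of the angle of [z] measured from the midpoint of the arc. *)
  pose u := (cos h * a + sin h * b) / s; pose v := (cos h * b - sin h * a) / s.
  have uv : u ^+ 2 + v ^+ 2 = 1.
    have -> : u ^+ 2 + v ^+ 2 = (cos h ^+ 2 + sin h ^+ 2) * (a ^+ 2 + b ^+ 2) / s ^+ 2.
      by rewrite /u /v; field; rewrite gt_eqF.
    by rewrite cos2Dsin2 ab mul1r divff // expf_neq0 // gt_eqF.
  have hu : cos h <= u by rewrite /u ler_pdivlMr // mulrC; lra.
  have [t [tI uE vE tlt]] := unit_circle_arc hI uv hu.
  exists t; split; first by rewrite thE.
    rewrite /g /circle_point -addrA; have -> : z = d + (a *: e1 + b *: e2).
      by rewrite -zE addrC subrK.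
    have -> : cos t = u * cos h - v * sin h by rewrite uE vE -cosD subrK.
    have -> : sin t = v * cos h + u * sin h by rewrite uE vE -sinD subrK.
    have c2 := cos2Dsin2 h.
    congr (_ + (_ *: _ + _ *: _)).
      rewrite /u /v -[LHS]mulr1 -c2; field; by rewrite gt_eqF.
    rewrite /u /v -[LHS]mulr1 -c2; field; by rewrite gt_eqF.
  move=> lt; rewrite thE; apply: tlt.
  by rewrite /u ltr_pdivlMr // mulrC; lra.
split; split=> //=.
- by rewrite -dot_gt0 /n dot_cross2 h1 h2 h12; lra.
- move=> z onz; split=> [|[nz wz]]; last by have [t [tI -> _]] := charA z onz nz wz; exact: Ag.
  rewrite AE => -[t /= /andP[t0 t1] <-]; rewrite -/(g t) gn gw; split=> //.
  rewrite lerD2l ler_pM2l //.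
  have [->|tn0] := eqVneq t 0; first by rewrite sub0r cosN.
  have [->|tn1] := eqVneq t th; first by rewrite thE (_ : _ - h = h) //; ring.
  apply: ltW; apply: cos_gt_arc => //.
  by rewrite !lt_def tn0 t0 -thE t1 eq_sym tn1.
- by rewrite xE; split; [apply: Ag; rewrite lexx ltW | rewrite gw sub0r cosN].
- rewrite yE; split; first by apply: Ag; rewrite lexx ltW.
  by rewrite gw thE (_ : _ - h = h) //; ring.
- move=> v t; rewrite /g /circle_point.
  have -> : (fun t => dot v (d + (s * cos t) *: e1 + (s * sin t) *: e2)) =
      (fun t => dot v d + s * dot v e1 * cos t + s * dot v e2 * sin t).
    by apply/funext => t'; rewrite !dotE; ring.
  apply: cvgD; first apply: cvgD.
  + exact: cvg_cst.
  + by apply: cvgM; [exact: cvg_cst | exact: continuous_cos].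
  + by apply: cvgM; [exact: cvg_cst | exact: continuous_sin].
- move=> t /andP[t0 t1]; split; first by apply: Ag; rewrite !ltW.
  by rewrite gw ltrD2l ltr_pM2l // cos_gt_arc // t0 -thE.
- move=> z Az lz; have onz := onS z Az.
  have nz : dot n z = dot n d by move: Az; rewrite AE => -[t _ <-]; exact: gn.
  by have [t [_ zE tlt]] := charA z onz nz (ltW lz); exists t; [exact: tlt | exact: zE].
Qed.
End CircularArcs.

(** * General position *)

Section Generic.
Variable R : realType.
Implicit Types (x y z c : 'rV[R]_3).

(** The direction is taken on the moment curve [(1, t, t^2)], which meets each plane through 0 in
    finitely many points. *)
Lemma generic_direction (I : finType) (v : I -> 'rV[R]_3) :
  (forall i, v i != 0) -> exists w, forall i, dot w (v i) != 0.
Proof.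
move=> v0; pose p i := Poly [:: v i 0 i0; v i 0 i1; v i 0 i2].
have p0 i : p i != 0.
  apply: contraNneq (v0 i) => /polyP E; apply/eqP; apply: vec3P; rewrite mxE.
  - by have := E 0%N; rewrite coef_Poly coef0.
  - by have := E 1%N; rewrite coef_Poly coef0.
  - by have := E 2%N; rewrite coef_Poly coef0.
have [t ht] := poly_avoid p0; exists (vec3 1 t (t ^+ 2)) => i.
apply: contraNneq (ht i); rewrite dot3E !vec3E horner_Poly /= => E.
by apply/eqP; rewrite -[RHS]E; ring.
Qed.

(* The sphere point comes from the stereographic image of the parabola
   [(t, t^2)], which no plane contains. *)
Lemma generic_sphere_point (I : finType) (n : I -> 'rV[R]_3) (k : I -> R) c (r : R) :
  0 < r -> (forall i, n i != 0) ->
  exists2 N, on_sphere c r N & forall i, dot (n i) N != k i.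
Proof.
move=> r0 n0; pose K i := dot (n i) c - k i.
(* The numerator of [dot (n i) N - k i] as a polynomial in the parameter [t] of the parabola. *)
pose p i := Poly [:: K i - r * n i 0 i2; 2 * r * n i 0 i0;
  K i + r * (2 * n i 0 i1 + n i 0 i2); 0; K i + r * n i 0 i2].
have p0 i : p i != 0.
  apply: contraNneq (n0 i) => /polyP E.
  have := E 0%N; rewrite coef_Poly coef0 /= => E0.
  have := E 1%N; rewrite coef_Poly coef0 /= => E1.
  have := E 2%N; rewrite coef_Poly coef0 /= => E2.
  have := E 4%N; rewrite coef_Poly coef0 /= => E4.
  have z0 : r * n i 0 i0 = 0 by lra.
  have z2 : r * n i 0 i2 = 0 by lra.
  have z1 : r * n i 0 i1 = 0 by lra.
  have rz q : r * q = 0 -> q = 0 by move/eqP; rewrite mulf_eq0 gt_eqF //= => /eqP.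
  by apply/eqP; apply: vec3P; rewrite mxE; exact: rz.
have [t ht] := poly_avoid p0.
have D0 : 0 < 1 + t ^+ 2 + t ^+ 4.
  by rewrite (_ : t ^+ 4 = (t ^+ 2) ^+ 2) ?ltr_pwDl ?addr_ge0 ?sqr_ge0 ?ltr_wpDr //; ring.
exists (c + (r / (1 + t ^+ 2 + t ^+ 4)) *: vec3 (2 * t) (2 * t ^+ 2) (t ^+ 4 + t ^+ 2 - 1)).
  rewrite /on_sphere addrC addKr dotZl dotZr dot3E !vec3E; field.
  by rewrite gt_eqF.
move=> i; apply: contraNneq (ht i); rewrite dotDr dotZr [dot _ (vec3 _ _ _)]dot3E !vec3E horner_Poly /= => E.
have {E} : K i * (1 + t ^+ 2 + t ^+ 4) + r * (n i 0 i0 * (2 * t) +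
    n i 0 i1 * (2 * t ^+ 2) + n i 0 i2 * (t ^+ 4 + t ^+ 2 - 1)) = 0.
  by rewrite /K -[X in _ - X]E; field; rewrite gt_eqF.
by move=> E; apply/eqP; rewrite -[RHS]E; ring.
Qed.
End Generic.

(** * Stereographic projection *)

Section SphereChart.
Variables (R : realType) (c N w omega : 'rV[R]_3) (r : R).
Implicit Types (x z v : 'rV[R]_3) (y : R * R).

Let g1 := cross omega w.
Let g2 := cross w g1.

Hypothesis r_gt0 : 0 < r.
Hypothesis wE : N - c = w.
Hypothesis N_on : on_sphere c r N.
Hypothesis g1_neq0 : g1 != 0.

(* Central projection from [N] onto a plane parallel to the tangent plane at
   [N]; on the sphere this is stereographic projection. *)
Definition depth x := dot w (x - N).

Definition chart x : R * R := (dot g1 (x - N) / depth x, dot g2 (x - N) / depth x).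

(** The direction of the projecting line through [N] that meets [y], scaled to have product 1 with
    [w]; its products with [g1] and [g2] are the coordinates of [y]. *)
Definition lift y : 'rV[R]_3 :=
  (dot w w)^-1 *: w + (y.1 / dot g1 g1) *: g1 + (y.2 / dot g2 g2) *: g2.

(** With [l = lift y] and [dot w l = 1], the equation [|w + s l|^2 = |w|^2] has the roots [s = 0],
    which is [N], and [s = - 2 / |l|^2]. *)
Definition unchart y := N - (2 / dot (lift y) (lift y)) *: lift y.

Let ww : dot w w = r ^+ 2.
Proof. by rewrite -wE. Qed.

Let ww_gt0 : 0 < dot w w.
Proof. by rewrite ww exprn_gt0. Qed.

Let wg1 : dot w g1 = 0.
Proof. exact: dot_crossr. Qed.

Let wg2 : dot w g2 = 0.
Proof. exact: dot_crossl. Qed.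

Let g1g2 : dot g1 g2 = 0.
Proof. exact: dot_crossr. Qed.

Let g1g1_gt0 : 0 < dot g1 g1.
Proof. by rewrite dot_gt0. Qed.

Let g2g2 : dot g2 g2 = dot w w * dot g1 g1.
Proof. by rewrite dot_cross2 wg1 expr0n subr0. Qed.

Let g2g2_gt0 : 0 < dot g2 g2.
Proof. by rewrite g2g2 mulr_gt0. Qed.

Lemma frame_decomposition z : z = (dot w z / dot w w) *: w
  + (dot g1 z / dot g1 g1) *: g1 + (dot g2 z / dot g2 g2) *: g2.
Proof.
have := cross_decomposition w g1 z; rewrite /= -/g2 wg1 !mul0r !subr0 => H.
have : (dot g2 g2)^-1 *: (dot g2 g2 *: z) = z by rewrite scalerA mulVf ?scale1r ?gt_eqF.
rewrite H !scalerDr !scalerA => E; rewrite -[LHS]E -addrA addrC. congr (_ *: _ + _ *: _ + _ *: _).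
- by rewrite g2g2; field; rewrite !gt_eqF.
- by rewrite g2g2; field; rewrite !gt_eqF.
- by rewrite mulrC.
Qed.

Lemma dot_lift v y : dot v (lift y) =
  dot v w / dot w w + y.1 * (dot v g1 / dot g1 g1) + y.2 * (dot v g2 / dot g2 g2).
Proof. by rewrite /lift !dotDr !dotZr; ring. Qed.

Lemma dotw_lift y : dot w (lift y) = 1.
Proof. by rewrite dot_lift wg1 wg2 !mul0r !mulr0 !addr0 divff ?gt_eqF. Qed.

Lemma dotg1_lift y : dot g1 (lift y) = y.1.
Proof.
by rewrite dot_lift (dotC g1 w) wg1 g1g2 !mul0r mulr0 addr0 add0r divff ?mulr1 ?gt_eqF.
Qed.

Lemma dotg2_lift y : dot g2 (lift y) = y.2.
Proof.
rewrite dot_lift (dotC g2 w) wg2 (dotC g2 g1) g1g2 !mul0r mulr0 !add0r.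
by rewrite divff ?mulr1 ?gt_eqF.
Qed.

Lemma lift_gt0 y : 0 < dot (lift y) (lift y).
Proof.
rewrite dot_gt0; apply/eqP => E; have := dotw_lift y.
by rewrite E dot0r => /eqP; rewrite eq_sym oner_eq0.
Qed.

Lemma lift_affine p q t : lift (p + t *: (q - p)) = lift p + t *: (lift q - lift p).
Proof.
have dR v : dot v (lift p + t *: (lift q - lift p)) =
    dot v (lift p) + t * (dot v (lift q) - dot v (lift p)).
  by move: (lift p) (lift q) => P Q; rewrite dotDr dotZr dotBr.
rewrite [LHS]frame_decomposition [RHS]frame_decomposition !dR.
by rewrite !dotw_lift !dotg1_lift !dotg2_lift subrr mulr0 addr0.
Qed.

Lemma dist_depth x : on_sphere c r x -> dot (x - N) (x - N) = - 2 * depth x.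
Proof.
rewrite /on_sphere -ww (_ : x - c = (x - N) + w); last by rewrite -wE addrA subrK.
by rewrite /depth; move: (x - N) => z; rewrite dotDl !dotDr (dotC z w) => E; lra.
Qed.

Lemma depth_lt0 x : on_sphere c r x -> x != N -> depth x < 0.
Proof.
move=> /dist_depth E xN; have : 0 < dot (x - N) (x - N) by rewrite dot_gt0 subr_eq0.
by rewrite E => h; lra.
Qed.

Lemma lift_chart x : on_sphere c r x -> x != N -> lift (chart x) = (depth x)^-1 *: (x - N).
Proof.
move=> onx xN; have d0 := depth_lt0 onx xN.
rewrite [RHS]frame_decomposition !dotZr /lift /chart /= -/(depth x).
congr (_ *: _ + _ *: _ + _ *: _); last 2 first.
- by rewrite [dot g1 _ / _]mulrC.
- by rewrite [dot g2 _ / _]mulrC.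
by rewrite mulVf ?mul1r // lt_eqF.
Qed.

Lemma chartK x : on_sphere c r x -> x != N -> unchart (chart x) = x.
Proof.
move=> onx xN; have d0 := depth_lt0 onx xN.
rewrite /unchart lift_chart // dotZl dotZr dist_depth // scalerA.
have -> : 2 / ((depth x)^-1 * ((depth x)^-1 * (-2 * depth x))) / depth x = - 1.
  by field; rewrite lt_eqF.
by rewrite scaleN1r opprK addrC subrK.
Qed.

Lemma unchart_on y : on_sphere c r (unchart y).
Proof.
have E : unchart y - c = w - (2 / dot (lift y) (lift y)) *: lift y.
  by rewrite /unchart -wE addrAC.
have l0 := lift_gt0 y; have lw := dotw_lift y.
rewrite /on_sphere E -ww dotBl !dotBr !dotZl !dotZr (dotC (lift y) w) lw.
by field; rewrite gt_eqF.
Qed.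

Lemma depth_unchart y : depth (unchart y) = - (2 / dot (lift y) (lift y)).
Proof. by rewrite /depth /unchart addrC addKr dotNr dotZr dotw_lift mulr1. Qed.

Lemma unchartK y : chart (unchart y) = y.
Proof.
have l0 := lift_gt0 y.
apply: pair_ext; rewrite /chart depth_unchart /= /unchart addrC addKr dotNr dotZr.
  by rewrite dotg1_lift; field; rewrite gt_eqF.
by rewrite dotg2_lift; field; rewrite gt_eqF.
Qed.

Lemma dot_unchart v y :
  dot v (unchart y) = dot v N - 2 / dot (lift y) (lift y) * dot v (lift y).
Proof. by rewrite /unchart dotBr dotZr. Qed.

Lemma dot_lift_continuous v : continuous (fun y => dot v (lift y)).
Proof.
move=> y; rewrite (_ : (fun y => _) = (fun y => dot v w / dot w w +
  y.1 * (dot v g1 / dot g1 g1) + y.2 * (dot v g2 / dot g2 g2))); last first.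
  by apply/funext => z; exact: dot_lift.
apply: cvgD; first apply: cvgD.
- exact: cvg_cst.
- by apply: cvgM; [exact: cvg_fst | exact: cvg_cst].
- by apply: cvgM; [exact: cvg_snd | exact: cvg_cst].
Qed.

Lemma lift_sqr_continuous : continuous (fun y => dot (lift y) (lift y)).
Proof.
move=> y; rewrite (_ : (fun y => _) = (fun y => dot w (lift y) / dot w w +
  y.1 * (dot g1 (lift y) / dot g1 g1) + y.2 * (dot g2 (lift y) / dot g2 g2))); last first.
  by apply/funext => z; rewrite dot_lift !(dotC (lift z)).
have cf := dot_lift_continuous.
apply: cvgD; first apply: cvgD.
- by apply: cvgM; [exact: cf | exact: cvg_cst].
- by apply: cvgM; [exact: cvg_fst | apply: cvgM; [exact: cf | exact: cvg_cst]].
- by apply: cvgM; [exact: cvg_snd | apply: cvgM; [exact: cf | exact: cvg_cst]].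
Qed.

(** Multiplied by [|lift p|^2], the plane equation of the arc becomes [curve p = 0], a circle
    because the plane misses [N]. On this circle [|lift p|^2] equals an affine function, so the
    half-space condition becomes an affine inequality [0 <= M p]. Since [M] vanishes at both ends,
    it cuts the circle along the chord. *)
Lemma chart_arc (x y : 'rV[R]_3) (A : set 'rV[R]_3) (d : arc_cut R) : cuts c r x y A d -> (forall z, A z -> on_sphere c r z) ->
  dot (normal d) N != level d -> (chart x).1 < (chart y).1 ->
  exists a : chordal_arc R,
  [/\ left_end a = chart x, right_end a = chart y, arc_wf a,
      connected [set p | in_arc a p] & exists p, in_arc a p] /\
  forall p, on_arc a p <-> A (unchart p).
Proof.
case: d => n k nu l g h [[/= n0 h0 AP] [[Ax nux] [Ay nuy] gcont gin gsurj]] onS nN xy.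
pose lN := dot n N - k; pose mN := dot nu N - l.
have lN0 : lN != 0 by rewrite subr_eq0.
pose curve p := dot (lift p) (lift p) - 2 / lN * dot n (lift p).
pose M p := mN / lN * dot n (lift p) - dot nu (lift p).
have planeE p : dot n (unchart p) - k = lN / dot (lift p) (lift p) * curve p.
  have l0 := lift_gt0 p; rewrite dot_unchart /curve /lN; field.
  by rewrite subr_eq0 nN gt_eqF.
have sideE p : curve p = 0 -> dot nu (unchart p) - l = 2 / dot (lift p) (lift p) * M p.
  move=> c0; have l0 := lift_gt0 p.
  have E : dot n (lift p) = lN * dot (lift p) (lift p) / 2.
    have : lN * curve p = lN * dot (lift p) (lift p) - 2 * dot n (lift p).
      by rewrite /curve; field.
    by rewrite c0 mulr0 => H; lra.
  by rewrite dot_unchart /M E /mN; field; rewrite lN0 gt_eqF.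
have AN z : A z -> z != N.
  by move=> Az; have [nz _] := (AP z (onS z Az)).1 Az; apply: contraNneq nN => <-; rewrite nz.
have curve0 p : curve p = 0 <-> dot n (unchart p) = k.
  have l0 := lift_gt0 p; split=> [E|E].
    by have := planeE p; rewrite E mulr0 => /subr0_eq.
  move: (planeE p); rewrite E subrr => /esym /eqP.
  by rewrite !mulf_eq0 (negPf lN0) invr_eq0 gt_eqF //= => /eqP.
have AE p : A (unchart p) <-> curve p = 0 /\ 0 <= M p.
  have l0 := lift_gt0 p.
  have pos : curve p = 0 -> (l <= dot nu (unchart p)) = (0 <= M p).
    by move=> /sideE E; rewrite -subr_ge0 E pmulr_rge0 // divr_gt0.
  split=> [/(AP _ (unchart_on p)).1 [/curve0 c0 lp]|[c0 Mp]].
    by rewrite c0 -pos.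
  by apply/(AP _ (unchart_on p)); rewrite pos //; split=> //; apply/curve0.
have sgn p : curve p = 0 -> (l < dot nu (unchart p)) = (0 < M p).
  by have l0 := lift_gt0 p; move=> /sideE E; rewrite -subr_gt0 E pmulr_rgt0 // divr_gt0.
pose C := mN / lN * (dot n g2 / dot g2 g2) - dot nu g2 / dot g2 g2.
pose B := mN / lN * (dot n g1 / dot g1 g1) - dot nu g1 / dot g1 g1.
have Mlin p q : M p = M q + (p.1 - q.1) * B + (p.2 - q.2) * C.
  by rewrite /M !dot_lift /B /C; ring.
have vertex z : A z -> dot nu z = l -> curve (chart z) = 0 /\ M (chart z) = 0.
  move=> Az nuz; have onz := onS z Az; have zN := AN z Az.
  have l0 := lift_gt0 (chart z).
  have c0 : curve (chart z) = 0 by apply/curve0; rewrite chartK //; have [] := (AP z onz).1 Az.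
  split=> //; have := sideE _ c0; rewrite chartK // nuz subrr => /esym /eqP.
  by rewrite mulf_eq0 gt_eqF ?divr_gt0 //= => /eqP.
have [cx Mx] := vertex x Ax nux; have [cy My] := vertex y Ay nuy.
(* Two affine functions vanishing at both ends of the chord are proportional. The sign of the factor
   [C] tells on which side the arc lies; [C] is nonzero since [M] is positive at an interior point
   of the arc. *)
have turnE p : ((chart y).1 - (chart x).1) * M p = C * turn (chart x) (chart y) p.
  have := Mlin (chart y) (chart x); rewrite Mx My (Mlin p (chart x)) Mx /turn.
  move: (chart x) (chart y) xy => [u1 u2] [v1 v2] /= _.
  rewrite !add0r => /esym E.
  have -> : (v1 - u1) * ((p.1 - u1) * B + (p.2 - u2) * C) =
    (p.1 - u1) * ((v1 - u1) * B + (v2 - u2) * C) + C * ((v1 - u1) * (p.2 - u2) - (v2 - u2) * (p.1 - u1)) by ring.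
  by rewrite E mulr0 add0r.
have d0 : 0 < (chart y).1 - (chart x).1 by rewrite subr_gt0.
have g_in t : 0 < t < h -> curve (chart (g t)) = 0 /\ 0 < M (chart (g t)).
  move=> /gin [Ag lg]; have ong := onS _ Ag; have gN := AN _ Ag.
  have c0 : curve (chart (g t)) = 0 by apply/curve0; rewrite chartK //; have [] := (AP _ ong).1 Ag.
  by split=> //; rewrite -sgn // chartK.
have mid : 0 < h / 2 < h by apply/andP; split; lra.
have [cm Mm] := g_in _ mid.
have C0 : C != 0.
  apply: contraTneq Mm => E; have := turnE (chart (g (h / 2))).
  by rewrite E mul0r => /eqP; rewrite mulf_eq0 gt_eqF //= => /eqP ->; rewrite ltxx.
pose a := ChordalArc (chart x) (chart y) curve (0 < C).
have M_gt0 p : (0 < M p) = (if above a then 0 < chord_turn a p else chord_turn a p < 0).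
  rewrite -(pmulr_rgt0 _ d0) turnE /=; case: ifP => [Cp|/negbT]; first by rewrite pmulr_rgt0.
  by rewrite -leNgt le_eqVlt (negPf C0) /= => Cn; rewrite nmulr_rgt0.
have M_ge0 p : (0 <= M p) = (if above a then 0 <= chord_turn a p else chord_turn a p <= 0).
  rewrite -(pmulr_rge0 _ d0) turnE /=; case: ifP => [Cp|/negbT]; first by rewrite pmulr_rge0.
  by rewrite -leNgt le_eqVlt (negPf C0) /= => Cn; rewrite nmulr_rge0.
have inaE p : in_arc a p = (curve p == 0) && (0 < M p) by rewrite M_gt0.
exists a; split; [split=> // | move=> p].
- split=> //.
  + move=> p; apply: cvgB; first exact: lift_sqr_continuous.
    by apply: cvgM; [exact: cvg_cst | exact: dot_lift_continuous].
  + pose D := lift (chart y) - lift (chart x).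
    exists (dot D D).
      rewrite dot_gt0; apply/eqP => D0; have : dot g1 D = 0 by rewrite D0 dot0r.
      by rewrite /D dotBr !dotg1_lift => E; rewrite E ltxx in d0.
    move=> t; rewrite /= /curve lift_affine -/D.
    have E : lift (chart y) = lift (chart x) + D by rewrite /D addrC subrK.
    have := cy; have := cx; rewrite /curve E; clear E; clearbody D; move: (lift (chart x)) D => P D'.
    rewrite !(dotDl, dotDr) !dotZl !dotZr (dotC D' P) => e1 e2.
    have -> : 2 / lN * (dot n P + t * dot n D') =
      2 / lN * dot n P + t * (2 / lN * dot n D') by ring.
    move: (2 / lN * dot n P) (2 / lN * (dot n P + dot n D')) (2 / lN * dot n D')
      (mulrDr (2 / lN) (dot n P) (dot n D')) e1 e2 => q1 q2 q3 q4 e1 e2.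
    have -> : q1 = dot P P by lra.
    have -> : q3 = 2 * dot P D' + dot D' D' by lra.
    by ring.
- pose f := fun t => chart (g t).
  have -> : [set p | in_arc a p] = f @` `]0, h[%classic.
    apply/seteqP; split=> [p /=|_ [t /= tI <-]].
      rewrite inaE => /andP[/eqP c0 Mp].
      have Ap : A (unchart p) by apply/AE; split=> //; exact: ltW.
      have lp : l < dot nu (unchart p) by rewrite sgn.
      have [t tI E] := gsurj _ Ap lp; exists t => //=.
      by rewrite /f -E unchartK.
    by rewrite in_itv /= in tI; have [c0 Mp] := g_in t tI; rewrite inaE c0 eqxx.
  apply: connected_continuous_connected.
    exact/connected_intervalP/interval_is_interval.
  apply: continuous_in_subspaceT => t; rewrite inE /= in_itv /= => tI.
  have [Ag _] := gin t tI.
  have dn0 : depth (g t) != 0 by rewrite lt_eqF // depth_lt0 //; [exact: onS | exact: AN].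
  have cdot v : {for t, continuous (fun t => dot v (g t - N))}.
    rewrite (_ : (fun t => _) = (fun t => dot v (g t) - dot v N)); last first.
      by apply/funext => t'; rewrite dotBr.
    by apply: cvgB; [exact: gcont | exact: cvg_cst].
  apply: (@pair_continuous _ _ (fun t => dot g1 (g t - N) / depth (g t))
    (fun t => dot g2 (g t - N) / depth (g t))).
    by apply: cvgM; [exact: cdot | apply: cvgV => //; exact: cdot].
  by apply: cvgM; [exact: cdot | apply: cvgV => //; exact: cdot].
- by exists (chart (g (h / 2))); rewrite inaE cm eqxx.
- rewrite AE /on_arc -M_ge0 /=; split=> [/andP[/eqP]|[-> ->]] //; by rewrite eqxx.
Qed.

End SphereChart.

(** * From a drawing on one sphere to a plane drawing *)

Lemma incidence_swap m n (src tgt src' tgt' : 'I_m -> 'I_n) :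
  (forall e, (src' e, tgt' e) = (src e, tgt e) \/ (src' e, tgt' e) = (tgt e, src e)) ->
  forall w e, incident src' tgt' w e = incident src tgt w e.
Proof. by move=> H w e; rewrite /incident; case: (H e) => -[-> ->] //; rewrite orbC. Qed.

Section SphereDrawing.
Variables (R : realType) (c : 'rV[R]_3) (r : R) (m n : nat).
Variables (pos : 'I_n.+1 -> 'rV[R]_3) (src tgt : 'I_m -> 'I_n.+1).
Variable A : 'I_m -> set 'rV[R]_3.
Hypothesis r_gt0 : 0 < r.
Hypothesis pos_inj : injective pos.
Hypothesis src_neq : forall e, src e != tgt e.
Hypothesis A_arc : forall e, is_circular_arc (pos (src e)) (pos (tgt e)) (A e).
Hypothesis A_on : forall e z, A e z -> on_sphere c r z.
Hypothesis A_disjoint : forall e f z, e != f -> A e z -> A f z ->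
  exists w, [/\ z = pos w, incident src tgt w e & incident src tgt w f].
Hypothesis A_avoid : forall e w, A e (pos w) -> incident src tgt w e.

(** The projected vectors have squared length [- 2 / depth], so equal images have equal depths and
    hence equal preimages. *)
Lemma projection_inj N w (x y : 'rV[R]_3) : N - c = w -> on_sphere c r N -> on_sphere c r x -> on_sphere c r y ->
  x != N -> y != N ->
  (dot w (x - N))^-1 *: (x - N) = (dot w (y - N))^-1 *: (y - N) -> x = y.
Proof.
move=> wE oN ox oy xN yN E.
have dx := depth_lt0 wE oN ox xN; have dy := depth_lt0 wE oN oy yN.
have ex := dist_depth wE oN ox; have ey := dist_depth wE oN oy.
rewrite /depth in dx dy ex ey.
set a := dot w (x - N) in E dx ex; set b := dot w (y - N) in E dy ey.
have : dot (a^-1 *: (x - N)) (a^-1 *: (x - N)) = dot (b^-1 *: (y - N)) (b^-1 *: (y - N)).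
  by rewrite E.
rewrite !dotZl !dotZr ex ey => E2.
have ab : a = b.
  have a0 : a != 0 by rewrite lt_eqF.
  have b0 : b != 0 by rewrite lt_eqF.
  have e1 : a^-1 * (a^-1 * (-2 * a)) = -2 / a by field.
  have e2 : b^-1 * (b^-1 * (-2 * b)) = -2 / b by field.
  have : a^-1 = b^-1 by rewrite e1 e2 in E2; lra.
  exact: invr_inj.
have b0 : b^-1 != 0 by rewrite invr_eq0 lt_eqF.
by move: E; rewrite ab => /(scalerI b0) /addIr.
Qed.

Theorem sphere_drawing_bound g :
  (forall z : 'rV['F_2]_m, z != 0 -> z *m incidence src tgt = 0 ->
     (g <= #|[set e | z 0%R e != 0%R]%SET|)%N) ->
  (m <= n)%N \/ (g * (m - n).+1 <= 2 * m)%N.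
Proof.
move=> girth; have [m0|m0] := posnP m; first by left; rewrite m0.
have e0 : 'I_m by exists 0%N.
have /choice [d hd] : forall e, exists d, cuts c r (pos (src e)) (pos (tgt e)) (A e) d.
  by move=> e; apply: arc_on_sphere (A_arc e) _ => z; exact: A_on.
have nd e : normal (d e) != 0 by case: (hd e) => -[].
have [N oN hN] := generic_sphere_point (fun e => level (d e)) c r_gt0 nd.
have [w0 w0E] : exists w0, N - c = w0 by exists (N - c).
have w0w0 : 0 < dot w0 w0 by rewrite -w0E oN exprn_gt0.
have tw w e : incident src tgt w e -> A e (pos w).
  by case: (hd e) => _ [[hx _] [hy _] _ _ _] /orP[] /eqP ->.
have AN e z : A e z -> z != N.
  move=> Az; have [[_ _ /(_ z (A_on Az))] [/(_ Az) [nz _] _] _] := hd e.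
  by apply: contraNneq (hN e) => <-; rewrite nz.
have on_touched w : touched src tgt w -> on_sphere c r (pos w) /\ pos w != N.
  by move=> /existsP[e /tw Aw]; split; [exact: A_on Aw | exact: AN Aw].
pose D w := (dot w0 (pos w - N))^-1 *: (pos w - N).
pose P (u : 'I_n.+1 * 'I_n.+1) := [&& touched src tgt u.1, touched src tgt u.2 & u.1 != u.2].
(* The abscissae of two vertices differ by the product of [omega] with this cross product. It is
   nonzero because [D u.1 - D u.2] is orthogonal to [w0]; [w0] itself is only a nonzero filler for
   the other pairs. *)
pose v u := if P u then cross w0 (D u.1 - D u.2) else w0.
have v0 u : v u != 0.
  rewrite /v; case: ifP => [/and3P[t1 t2 ne]|_]; last by rewrite -dot_gt0.
  have [o1 n1] := on_touched _ t1; have [o2 n2] := on_touched _ t2.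
  have wD w : touched src tgt w -> dot w0 (D w) = 1.
    move=> /on_touched [o nn]; rewrite dotZr mulVf // lt_eqF //.
    by have := depth_lt0 w0E oN o nn.
  rewrite -dot_gt0 dot_cross2 [dot w0 (_ - _)]dotBr !wD // subrr expr0n subr0 mulr_gt0 // dot_gt0 subr_eq0.
  apply: contra ne => /eqP E; apply/eqP/pos_inj.
  exact: projection_inj w0E oN o1 o2 n1 n2 E.
have [omega hom] := generic_direction v0.
pose ch := chart N w0 omega.
have chD w : (ch (pos w)).1 = dot (cross omega w0) (D w).
  by rewrite /ch /chart /= dotZr mulrC.
have ch_neq w w' : touched src tgt w -> touched src tgt w' -> w != w' ->
    (ch (pos w)).1 != (ch (pos w')).1.
  move=> t1 t2 ne; rewrite !chD -subr_eq0 -dotBr dot_cross_cyc.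
  by have := hom (w, w'); rewrite /v /P /= t1 t2 ne.
have ts e : touched src tgt (src e) by apply/existsP; exists e; rewrite /incident eqxx.
have tt e : touched src tgt (tgt e) by apply/existsP; exists e; rewrite /incident eqxx orbT.
have g1_neq0 : cross omega w0 != 0.
  apply/eqP => E; have := ch_neq _ _ (ts e0) (tt e0) (src_neq e0).
  by rewrite !chD E !(dotC 0) !dot0r eqxx.
pose lt e := (ch (pos (src e))).1 < (ch (pos (tgt e))).1.
(* Ends are swapped where necessary to put the left end first; incidence does not see the order. *)
pose src' e := if lt e then src e else tgt e.
pose tgt' e := if lt e then tgt e else src e.
have inc : forall w e, incident src' tgt' w e = incident src tgt w e.
  by apply: incidence_swap => e; rewrite /src' /tgt'; case: (lt e); [left | right].
have tou w : touched src' tgt' w = touched src tgt w by apply: eq_existsb => e; exact: inc.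
pose Pa e (a : chordal_arc R) := [/\ left_end a = ch (pos (src' e)),
  right_end a = ch (pos (tgt' e)), arc_wf a,
  connected [set p | in_arc a p] & exists p, in_arc a p] /\
  forall p, on_arc a p <-> A e (unchart N w0 omega p).
have /choice [a ha] : forall e, exists a, Pa e a.
  move=> e; have arcs := chart_arc r_gt0 w0E oN g1_neq0.
  rewrite /Pa /src' /tgt'; case l : (lt e).
    exact: (arcs _ _ _ _ (hd e) (@A_on e) (hN e)).
  apply: (arcs _ _ _ _ (cuts_sym (hd e)) (@A_on e) (hN e)).
  by rewrite lt_neqAle eq_sym ch_neq // leNgt; move/negbT: l.
have /choice [pt hpt] : forall e, exists p, in_arc (a e) p by move=> e; case: (ha e) => -[].
have onA e p : on_arc (a e) p <-> A e (unchart N w0 omega p) by case: (ha e).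
have chK w : touched src tgt w -> unchart N w0 omega (ch (pos w)) = pos w.
  move=> /on_touched [o nn]; exact: (chartK r_gt0 w0E oN g1_neq0 o nn).
have wf e : arc_wf (a e) by case: (ha e) => -[].
have sE e : left_end (a e) = ch (pos (src' e)) by case: (ha e) => -[].
have tE e : right_end (a e) = ch (pos (tgt' e)) by case: (ha e) => -[].
have pinj w w' : touched src' tgt' w -> touched src' tgt' w' ->
    (ch (pos w)).1 = (ch (pos w')).1 -> w = w'.
  rewrite !tou => t1 t2 E; apply/eqP; apply: contraT => /(ch_neq _ _ t1 t2).
  by rewrite E eqxx.
have dis e f p : e != f -> on_arc (a e) p -> on_arc (a f) p ->
    exists w, [/\ p = ch (pos w), incident src' tgt' w e & incident src' tgt' w f].
  move=> ef /onA Ae /onA Af; have [w [E we wf']] := A_disjoint ef Ae Af.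
  exists w; rewrite !inc; split=> //; rewrite -E.
  by rewrite /ch (unchartK r_gt0 w0E oN g1_neq0).
have avo e w : touched src' tgt' w -> on_arc (a e) (ch (pos w)) -> incident src' tgt' w e.
  by rewrite tou inc => /chK E /onA; rewrite E; exact: A_avoid.
have con e : connected [set p | in_arc (a e) p] by case: (ha e) => -[].
have incE : incidence src' tgt' = incidence src tgt.
  by apply/matrixP => e w; rewrite !mxE inc.
rewrite -incE in girth.
pose cpos w := ch (pos w).
exact: (face_count (incidence1 (pos := cpos) wf sE tE) girth
  (cell_boundary_even (pos := cpos) wf sE tE pinj dis avo con hpt)).
Qed.
End SphereDrawing.

(** * Edges covered by spheres *)

Section Girth.
Variables (m n : nat) (src tgt : 'I_m -> 'I_n) (z : 'rV['F_2]_m).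
Hypothesis z_even : z *m incidence src tgt = 0.

(** Over F_2 an edge of the support cannot be the only one at a vertex. *)
Lemma even_degree w e : z 0 e != 0 -> incident src tgt w e ->
  exists f, [/\ f != e, z 0 f != 0 & incident src tgt w f].
Proof.
move=> ze we; apply: contrapT => H.
have /matrixP /(_ 0 w) := z_even; rewrite !mxE (bigD1 e) //= mxE we mulr1 big1 ?addr0.
  by apply/eqP.
move=> f fe; rewrite mxE; case wf : (incident src tgt w f); last by rewrite mulr0.
have [->|zf] := eqVneq (z 0 f) 0; first by rewrite mul0r.
by case: H; exists f.
Qed.

Lemma card_support (s : seq 'I_m) : uniq s -> (forall e, e \in s -> z 0 e != 0) ->
  (size s <= #|[set e | z 0%R e != 0%R]%SET|)%N.
Proof.
move=> us hs; rewrite cardE; apply: uniq_leq_size => // e es.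
by rewrite mem_enum inE; exact: hs.
Qed.

Hypothesis z_neq0 : z != 0.

Lemma support_nonempty : exists e, z 0 e != 0.
Proof. by have /matrix0Pn [i [e]] := z_neq0; rewrite ord1; exists e. Qed.

Hypothesis simple : forall e f u v, u != v -> incident src tgt u e -> incident src tgt v e ->
  incident src tgt u f -> incident src tgt v f -> e = f.
Hypothesis src_neq : forall e, src e != tgt e.

Lemma incident_src e : incident src tgt (src e) e.
Proof. by rewrite /incident eqxx. Qed.

Lemma incident_tgt e : incident src tgt (tgt e) e.
Proof. by rewrite /incident eqxx orbT. Qed.

(** Evenness gives one further support edge at each end of [e]; were they equal, this edge would be
    parallel to [e]. *)
Lemma girth3 : (3 <= #|[set e | z 0%R e != 0%R]%SET|)%N.
Proof.
have [e ze] := support_nonempty.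
have [f [fe zf uf]] := even_degree ze (incident_src e).
have [h [he zh vh]] := even_degree ze (incident_tgt e).
apply: (@card_support [:: e; f; h]) => [|x]; last first.
  by rewrite !inE => /or3P[] /eqP ->.
rewrite /= !inE negb_or ![e == _]eq_sym fe he /= andbT.
apply: contraNneq fe => fh; rewrite -fh in vh.
by rewrite (simple (src_neq e) (incident_src e) (incident_tgt e) uf vh).
Qed.

(** The path [h], [e], [f] is continued at the far end [v'] of [f]. That end has the colour of
    [tgt e], so [h] does not contain it and the continuing edge is a fourth one. *)
Lemma girth4 (col : 'I_n -> bool) : (forall e, col (src e) != col (tgt e)) ->
  (4 <= #|[set e | z 0%R e != 0%R]%SET|)%N.
Proof.
move=> hcol.
have colE e u v : incident src tgt u e -> incident src tgt v e -> u != v -> col u != col v.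
  move=> /orP[] /eqP -> /orP[] /eqP -> ne.
  - by rewrite eqxx in ne.
  - exact: hcol.
  - by rewrite eq_sym; exact: hcol.
  - by rewrite eqxx in ne.
have [e ze] := support_nonempty.
set u := src e; set v := tgt e.
have [f [fe zf uf]] := even_degree ze (incident_src e).
have [h [he zh vh]] := even_degree ze (incident_tgt e).
have [v' [v'f v'u]] : exists v', incident src tgt v' f /\ v' != u.
  have [E|ne] := eqVneq (src f) u; last by exists (src f); rewrite incident_src.
  by exists (tgt f); rewrite incident_tgt -E eq_sym src_neq.
have v'v : v' != v.
  apply: contraNneq fe => E; rewrite E in v'f.
  by rewrite (simple (src_neq e) (incident_src e) (incident_tgt e) uf v'f).
have [k [kf zk v'k]] := even_degree zf v'f.
have v'e : ~~ incident src tgt v' e by rewrite /incident negb_or v'u.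
have v'h : ~~ incident src tgt v' h.
  apply/negP => H; have c1 := colE h v' v H vh v'v.
  have c2 := colE e u v (incident_src e) (incident_tgt e) (src_neq e).
  have c3 := colE f v' u v'f uf v'u.
  by move: c1 c2 c3; case: (col v'); case: (col v); case: (col u).
apply: (@card_support [:: e; f; h; k]) => [|x]; last first.
  by rewrite !inE => /or4P[] /eqP ->.
have fh : f != h by apply: contraNneq v'h => <-.
have ek : e != k by apply: contraNneq v'e => ->.
have hk : h != k by apply: contraNneq v'h => ->.
by rewrite /= !inE !negb_or ek hk fh eq_sym fe eq_sym he eq_sym kf.
Qed.
End Girth.

(** * Arcs in a union of spheres *)

Section SphereCover.
Variable R : realType.

Lemma is_sphereE (S : set 'rV[R]_3) : is_sphere 2 S ->
  exists c r, 0 < r /\ S = [set x | on_sphere c r x].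
Proof.
move=> [c [r [W [r0 Wfree ->]]]]; exists c, r; split=> //.
have Wfull : row_full W by exact: Wfree.
apply/seteqP; split=> x /=; rewrite /on_sphere /enorm.
  by move=> [_ <-]; rewrite sqr_sqrtr // dot_ge0.
by move=> ->; rewrite submx_full // sqrtr_sqr gtr0_norm.
Qed.

Lemma arc_in_one_sphere k (c : 'I_k -> 'rV[R]_3) (r : 'I_k -> R) x y A :
  is_circular_arc x y A -> (forall z, A z -> exists i, on_sphere (c i) (r i) z) ->
  exists i, forall z, A z -> on_sphere (c i) (r i) z.
Proof.
move=> [d [e1 [e2 [s [th [[h1 h2 h12] s0 /andP[th0 _] _ AE]]]]]] cov.
(* Sample parameters stay below [pi], where the cosine is injective, as [circle_line3] wants
   distinct cosines. *)
have pp := @pi_gt0 R; pose M := Num.min th pi.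
have M0 : 0 < M by rewrite lt_min th0.
have Mth : M <= th by rewrite ge_min lexx.
have Mpi : M <= pi by rewrite ge_min lexx orbT.
(* [2k + 1] samples on [k] spheres put three on one of them. *)
pose K := (2 * k)%N; pose t (j : 'I_K.+1) : R := M * (j%:R / K.+1%:R).
have K0 : 0 < K.+1%:R :> R by rewrite ltr0n.
have tI j : 0 <= t j <= M.
  rewrite mulr_ge0 ?divr_ge0 ?ler0n ?(ltW M0) //= ger_pMr // ler_pdivrMr // mul1r.
  by rewrite ler_nat ltnW.
have t_inj i j : i != j -> cos (t i) != cos (t j).
  have tpi l : t l \in `[0, pi] by have /andP[? ?] := tI l; rewrite in_itv /=; apply/andP; split; lra.
  have Mn : M != 0 by rewrite gt_eqF.
  have Kn : (K.+1%:R : R)^-1 != 0 by rewrite invr_eq0 gt_eqF.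
  apply: contraNneq => /(cos_inj (tpi i) (tpi j)) /(mulfI Mn) /(mulIf Kn) /eqP.
  by rewrite eqr_nat.
have /choice [f hf] : forall j, exists i, on_sphere (c i) (r i) (circle_point d e1 e2 s (t j)).
  move=> j; apply: cov; rewrite AE; exists (t j) => //=.
  by have /andP[-> ?] := tI j; lra.
have [i hi] : exists i, (2 < #|[pred j | f j == i]|)%N.
  apply/existsP; apply: contraT; rewrite negb_exists => /forallP H.
  have : (#|'I_K.+1| <= \sum_(i < k) 2)%N.
    rewrite -sum1_card (partition_big f xpredT) //=; apply: leq_sum => i _.
    have := H i; rewrite -leqNgt; apply: leq_trans.
    by rewrite sum1_card; apply: eq_leq; apply: eq_card.
  by rewrite card_ord sum_nat_const card_ord mulnC ltnn.
have [j1 [j2 [j3 [[/eqP f1 /eqP f2 /eqP f3] [n12 n23 n31]]]]] := card_gt2P hi.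
exists i => z; rewrite AE => -[u _ <-].
have eqn j : f j = i -> dot (d - c i) (d - c i) + s ^+ 2 - r i ^+ 2
    + (2 * s * dot e1 (d - c i)) * cos (t j) + (2 * s * dot e2 (d - c i)) * sin (t j) = 0.
  by move=> E; have := hf j; rewrite E /on_sphere circle_point_dist // => E'; lra.
rewrite eq_sym in n31.
have [E0 E1 E2] := circle_line3 (cos2Dsin2 _) (cos2Dsin2 _) (cos2Dsin2 _)
  (t_inj _ _ n12) (t_inj _ _ n31) (t_inj _ _ n23) (eqn _ f1) (eqn _ f2) (eqn _ f3).
by rewrite /on_sphere circle_point_dist // E1 E2; lra.
Qed.
End SphereCover.

Lemma set2_eqP (T : finType) (u v u' v' : T) : [set u; v]%SET = [set u'; v']%SET ->
  u != v -> (u = u' /\ v = v') \/ (u = v' /\ v = u').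
Proof.
move=> E uv; have := set21 u v; have := set22 u v; rewrite E !inE.
case/orP=> /eqP vE /orP[] /eqP uE; first by rewrite uE vE eqxx in uv.
- by right.
- by left.
- by rewrite uE vE eqxx in uv.
Qed.

Section GraphBound.
Variable R : realType.

(** A bound from below for the size of a nonempty even edge set: 3 in a simple graph, 4 if there is
    a proper 2-colouring. *)
Definition even_girth (G : graph) (g : nat) : Prop :=
  g = 3%N \/ (g = 4%N /\ exists col : G -> bool, forall u v, adj u v -> col u != col v).

Lemma edgesP (G : graph) (e : {set G}) : e \in edges G ->
  exists u v, adj u v /\ e = [set u; v]%SET.
Proof. by rewrite inE => /existsP[u /existsP[v /andP[uv /eqP ->]]]; exists u, v. Qed.

Lemma adj_neq (G : graph) (u v : G) : adj u v -> u != v.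
Proof. by apply: contraTneq => ->; rewrite adj_irrefl. Qed.

Lemma adj_edge (G : graph) (u v : G) : adj u v -> [set u; v]%SET \in edges G.
Proof. by move=> uv; rewrite inE; apply/existsP; exists u; apply/existsP; exists v; rewrite uv eqxx. Qed.

Lemma one_sphere_bound (G : graph) n (D : drawing R 3 G) (E : {set {set G}}) c r g :
  #|G| = n.+1 -> crossing_free D -> 0 < r -> even_girth G g ->
  (forall e, e \in E -> e \in edges G) ->
  (forall e z, e \in E -> Defs.arc D e z -> on_sphere c r z) ->
  (#|E| <= n)%N \/ (g * (#|E| - n).+1 <= 2 * #|E|)%N.
Proof.
move=> cardG [avoid disj] r0 girth EG onS.
pose ev (i : 'I_n.+1) : G := enum_val (cast_ord (esym cardG) i).
pose rk (x : G) : 'I_n.+1 := cast_ord cardG (enum_rank x).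
have rkK x : ev (rk x) = x by rewrite /ev /rk cast_ordK enum_rankK.
have evK i : rk (ev i) = i by rewrite /ev /rk enum_valK cast_ordKV.
have ev_inj : injective ev := can_inj evK.
pose ed (i : 'I_#|E|) := enum_val i.
have edE i : ed i \in E by exact: enum_valP.
have ed_inj : injective ed by exact: enum_val_inj.
have /choice [uv huv] : forall i, exists p : G * G, adj p.1 p.2 /\ ed i = [set p.1; p.2]%SET.
  by move=> i; have [u [v [a e]]] := edgesP (EG _ (edE i)); exists (u, v).
pose src i := rk (uv i).1; pose tgt i := rk (uv i).2.
have src_neq i : src i != tgt i.
  by rewrite (inj_eq (can_inj rkK)) adj_neq //; case: (huv i).
have inc w i : incident src tgt w i = (ev w \in ed i).
  by case: (huv i) => _ ->; rewrite !inE /incident -!(inj_eq ev_inj) !rkK.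
have simple i j u v : u != v -> incident src tgt u i -> incident src tgt v i ->
    incident src tgt u j -> incident src tgt v j -> i = j.
  rewrite !inc => ne ui vi uj vj; apply: ed_inj.
  have ne' : ev u != ev v by rewrite (inj_eq ev_inj).
  have pairE k : ev u \in ed k -> ev v \in ed k -> ed k = [set ev u; ev v]%SET.
    case: (huv k) => _ ->; rewrite !inE => /orP[] /eqP h1 /orP[] /eqP h2.
    - by rewrite h1 h2 eqxx in ne'.
    - by rewrite h1 h2.
    - by rewrite h1 h2 finset.setUC.
    - by rewrite h1 h2 eqxx in ne'.
  by rewrite (pairE i) // (pairE j).
apply: (@sphere_drawing_bound R c r _ n (fun w => pos D (ev w)) src tgt (fun i => Defs.arc D (ed i))).
- exact: r0.
- by move=> i j /(@pos_inj _ _ _ D) /ev_inj.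
- exact: src_neq.
- by move=> i; rewrite /src /tgt !rkK; case: (huv i) => a ->; exact: arcP.
- by move=> i z; exact: onS.
- move=> i j z ij zi zj.
  have ne : ed i != ed j by rewrite (inj_eq ed_inj).
  have [w [wi wj ->]] := disj _ _ _ (EG _ (edE i)) (EG _ (edE j)) ne zi zj.
  by exists (rk w); rewrite !inc rkK.
- by move=> i w Aw; rewrite inc; exact: (avoid _ _ (EG _ (edE i)) Aw).
move=> z z0 zB; case: girth => [->|[-> [col hcol]]].
  exact: (girth3 zB z0 simple src_neq).
apply: (girth4 zB z0 simple src_neq (col := fun w => col (ev w))) => i.
by rewrite /src /tgt !rkK hcol //; case: (huv i).
Qed.

Lemma coverable_edges (G : graph) n k g : #|G| = n.+1 -> (2 <= n)%N -> even_girth G g ->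
  coverable R 2 3 G k -> ((g - 2) * #|edges G| <= k * (g * (n - 1)))%N.
Proof.
move=> cardG n2 girth [S [Ssph [D [cf [_ Din]]]]].
have /choice [cr hcr] : forall i, exists p : 'rV[R]_3 * R,
    0 < p.2 /\ S i = [set x | on_sphere p.1 p.2 x].
  by move=> i; have [c [r H]] := is_sphereE (Ssph i); exists (c, r).
pose E i := [set e in edges G | `[< forall z, Defs.arc D e z -> on_sphere (cr i).1 (cr i).2 z >]]%SET.
have one i : ((g - 2) * #|E i| <= g * (n - 1))%N.
  have [r0 _] := hcr i.
  have EG e : e \in E i -> e \in edges G by rewrite inE => /andP[].
  have onS e z : e \in E i -> Defs.arc D e z -> on_sphere (cr i).1 (cr i).2 z.
    by rewrite inE => /andP[_ /asboolP]; exact.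
  (* Euler's alternative rearranges to the claim; the forest alternative [m <= n] meets it since [n]
     is at least 2. *)
  have := one_sphere_bound cardG cf r0 girth EG onS.
  move: (#|E i|) => m; case: girth => [->|[-> _]]; lia.
apply: (@leq_trans (\sum_(i < k) (g - 2) * #|E i|)); last first.
  rewrite -[X in (_ <= X * _)%N]card_ord -sum_nat_const; apply: leq_sum => i _; exact: one.
rewrite -big_distrr leq_mul2l; apply/orP; right.
have cov e : e \in edges G -> exists i, e \in E i.
  move=> eG; have [u [v [a eE]]] := edgesP eG.
  have arce : is_circular_arc (pos D u) (pos D v) (Defs.arc D e) by rewrite eE; exact: arcP.
  have [|i hi] := @arc_in_one_sphere R k (fun i => (cr i).1) (fun i => (cr i).2) _ _ _ arce.
    move=> z /(Din e eG) [i _ Siz]; exists i; move: Siz.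
    by have [_ ->] := hcr i.
  by exists i; rewrite inE eG; apply/asboolP.
rewrite -sum1_card.
apply: (@leq_trans (\sum_(e in edges G) \sum_(i < k | e \in E i) 1)).
  apply: leq_sum => e /cov [i ei]; rewrite (bigD1 i) //=; lia.
rewrite (exchange_big_dep xpredT) //=; apply: leq_sum => i _.
rewrite -sum1_card [X in (X <= _)%N]big_mkcond [X in (_ <= X)%N]big_mkcond.
by apply: leq_sum => e _; case: (e \in E i); rewrite ?andbF //; case: ifP.
Qed.
End GraphBound.

(** * Drawings on spheres through a common circle *)

Section Construction.
Variable R : realType.
Implicit Types (x y z c : 'rV[R]_3) (k : R).

Lemma is_circular_arc_sym x y A : is_circular_arc x y A -> is_circular_arc y x A.
Proof.
move=> [c [e1 [e2 [r [th [[h1 h2 h12] r0 tI [xE yE] AE]]]]]].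
pose f1 := cos th *: e1 + sin th *: e2; pose f2 := sin th *: e1 - cos th *: e2.
have E t : circle_point c f1 f2 r t = circle_point c e1 e2 r (th - t).
  by apply: vec3P; rewrite /circle_point /f1 /f2 cosB sinB !mxE; ring.
have cs := cos2Dsin2 th.
exists c, f1, f2, r, th; split=> //.
- have d1 : dot f1 f1 = 1 by rewrite /f1 !dotE h1 h2 (dotC e2) h12; lra.
  have d2 : dot f2 f2 = 1 by rewrite /f2 !dotE h1 h2 (dotC e2) h12; lra.
  by have d3 : dot f1 f2 = 0 by rewrite /f1 /f2 !dotE h1 h2 (dotC e2) h12; lra.
- by rewrite !E subr0 subrr.
- rewrite AE; apply/seteqP; split=> _ [t /= /andP[t0 t1] <-]; exists (th - t) => /=.
  + by apply/andP; split; lra.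
  + by rewrite E (_ : th - (th - t) = t) //; ring.
  + by apply/andP; split; lra.
  + by rewrite E.
Qed.

(** [I e] stands for the arc of [e] without its ends. Crossing-freeness is reduced to these sets
    being pairwise disjoint and free of vertices, with one arc given per edge in either
    direction. *)
Lemma coverable_from (G : graph) m (S : 'I_m -> set 'rV[R]_3) (pos : G -> 'rV[R]_3)
    (I : {set G} -> set 'rV[R]_3) :
  (forall i, is_sphere 2 (S i)) -> injective pos -> (forall v, exists i, S i (pos v)) ->
  (forall e, e \in edges G -> exists u v A, [/\ e = [set u; v]%SET, adj u v,
     is_circular_arc (pos u) (pos v) A &
     forall x, A x -> [\/ x = pos u, x = pos v | I e x]]) ->
  (forall e x, e \in edges G -> I e x -> (exists i, S i x) /\ forall w, x != pos w) ->
  (forall e f x, e \in edges G -> f \in edges G -> I e x -> I f x -> e = f) ->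
  coverable R 2 3 G m.
Proof.
move=> Ssph pos_inj posS arcs Ipos Idis; exists S; split=> //.
have /choice [A hA] : forall e, exists A, e \in edges G ->
    (forall u v, e = [set u; v]%SET -> is_circular_arc (pos u) (pos v) A) /\
    forall x, A x -> (exists2 w, w \in e & x = pos w) \/ I e x.
  move=> e; case eG : (e \in edges G); last by exists set0.
  have [u [v [A [eE a arcA AI]]]] := arcs e eG; exists A => _; split.
    move=> u' v' E; rewrite eE in E; have [[<- <-]//|[<- <-]] := set2_eqP E (adj_neq a).
    exact: is_circular_arc_sym.
  move=> x /AI [->|->|]; [left|left|by right].
    by exists u => //; rewrite eE !inE eqxx.
  by exists v => //; rewrite eE !inE eqxx orbT.
have arcP u v : adj u v -> is_circular_arc (pos u) (pos v) (A [set u; v]%SET).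
  by move=> a; have [H _] := hA _ (adj_edge a); exact: H.
exists (Drawing pos_inj arcP); split; last first.
  split=> [v|e eG x /= Ax]; first by have [i Si] := posS v; exists i.
  have [_ /(_ x Ax) [[w _ ->]|Ix]] := hA e eG; first by have [i Si] := posS w; exists i.
  by have [[i Si] _] := Ipos e x eG Ix; exists i.
split=> [e w eG /= Aw|e f x eG fG ef /= Ae Af].
  have [_ /(_ _ Aw) [[w' w'e /pos_inj ->]//|Ix]] := hA e eG.
  by have [_ /(_ w)] := Ipos e _ eG Ix; rewrite eqxx.
have [_ /(_ x Ae) [[w we xw]|Ie]] := hA e eG; have [_ /(_ x Af) [[w' wf xw']|If]] := hA f fG.
- by exists w; split=> //; rewrite (_ : w = w') //; apply: pos_inj; rewrite -xw.
- by have [_ /(_ w)] := Ipos f x fG If; rewrite xw eqxx.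
- by have [_ /(_ w')] := Ipos e x eG Ie; rewrite xw' eqxx.
- by rewrite (Idis e f x) // eqxx in ef.
Qed.

Lemma is_sphere_on c (r : R) : 0 < r -> is_sphere 2 [set x | on_sphere c r x].
Proof.
move=> r0; exists c, r, 1%:M; split=> //; first by rewrite row_free_unit unitmx1.
apply/seteqP; split=> x /=; rewrite /on_sphere /enorm submx1.
  by move=> ->; rewrite sqrtr_sqr gtr0_norm.
by move=> [_ <-]; rewrite sqr_sqrtr // dot_ge0.
Qed.

(* The spheres through the unit circle of the plane [z = 0]; the centre of
   [pencil k] is chosen so that its poles have heights [k^-1] and [- k]. *)
Definition pencil_height k : R := (1 - k ^+ 2) / (2 * k).

Definition pencil k : set 'rV[R]_3 :=
  [set x | x 0 i0 ^+ 2 + x 0 i1 ^+ 2 + x 0 i2 ^+ 2 - 1 = 2 * pencil_height k * x 0 i2].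

Lemma is_sphere_pencil k : is_sphere 2 (pencil k).
Proof.
set h := pencil_height k; pose r := Num.sqrt (1 + h ^+ 2).
have r2 : r ^+ 2 = 1 + h ^+ 2 by rewrite sqr_sqrtr // addr_ge0 ?sqr_ge0.
have r0 : 0 < r by rewrite sqrtr_gt0 ltr_pwDl ?sqr_ge0.
rewrite (_ : pencil k = [set x | on_sphere (vec3 0 0 h) r x]); first exact: is_sphere_on.
by apply/seteqP; split=> x; rewrite /pencil /on_sphere /= -/h r2 dot3E !mxE /=; lra.
Qed.

Lemma pencil_heightV k : k != 0 -> pencil_height (- k^-1) = pencil_height k.
Proof. by move=> k0; rewrite /pencil_height; field. Qed.

(** A point off the plane of the common circle determines [pencil_height], which takes the same
    value at [k] and [- k^-1] only. These have opposite signs, and the sign of the height selects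
    one: thus [k] labels a cap. *)
Lemma pencil_inj k k' x : 0 < k * x 0 i2 -> 0 < k' * x 0 i2 ->
  pencil k x -> pencil k' x -> k = k'.
Proof.
move=> kx k'x; have x0 : x 0 i2 != 0 by apply: contraTneq kx => ->; rewrite mulr0 ltxx.
have k0 : k != 0 by apply: contraTneq kx => ->; rewrite mul0r ltxx.
have k'0 : k' != 0 by apply: contraTneq k'x => ->; rewrite mul0r ltxx.
rewrite /pencil /= => -> /(mulIf x0); rewrite /pencil_height => E.
have {}E : (1 - k ^+ 2) * k' = (1 - k' ^+ 2) * k.
  have -> : (1 - k ^+ 2) * k' = 2 * ((1 - k ^+ 2) / (2 * k)) * (k * k') by field.
  by rewrite E; field.
have : (k' - k) * (1 + k * k') = 0 by lra.
have kk : 0 < k * k'.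
  have := mulr_gt0 kx k'x.
  have -> : k * x 0 i2 * (k' * x 0 i2) = (k * k') * x 0 i2 ^+ 2 by ring.
  by rewrite pmulr_lgt0 // exprn_even_gt0.
by move/eqP; rewrite mulf_eq0 subr_eq0 [X in _ || X]gt_eqF ?addr_gt0 // orbF => /eqP.
Qed.

(** The unit circle parametrised by the tangent of half the angle: integer parameters give distinct
    points in cyclic order, and identities stay rational. *)
Definition circ (t : R) : 'rV[R]_3 := vec3 ((1 - t ^+ 2) / (1 + t ^+ 2)) (2 * t / (1 + t ^+ 2)) 0.

Lemma circ_denom (t : R) : 1 + t ^+ 2 != 0.
Proof. by rewrite gt_eqF // ltr_pwDl ?sqr_ge0. Qed.

Lemma circ_unit t : circ t 0 i0 ^+ 2 + circ t 0 i1 ^+ 2 = 1.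
Proof. by rewrite !vec3E; field; exact: circ_denom. Qed.

Lemma circ2 t : circ t 0 i2 = 0.
Proof. by rewrite vec3E. Qed.

Lemma circ_ratio t : circ t 0 i1 / (1 + circ t 0 i0) = t.
Proof.
have d0 := circ_denom t; rewrite !vec3E.
have -> : 1 + (1 - t ^+ 2) / (1 + t ^+ 2) = 2 / (1 + t ^+ 2) by field.
by field.
Qed.

Lemma circ_inj : injective circ.
Proof. by move=> s t E; rewrite -(circ_ratio s) -(circ_ratio t) E. Qed.

Lemma circ_pencil t k : pencil k (circ t).
Proof. by rewrite /pencil /= circ2 circ_unit; ring. Qed.
End Construction.

(** * Meridians and arcs over chords *)

Section PencilArcs.
Variable R : realType.
Implicit Types (x u v : 'rV[R]_3) (k : R).

Lemma meridian_arc k u : k != 0 -> u 0 i2 = 0 -> u 0 i0 ^+ 2 + u 0 i1 ^+ 2 = 1 ->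
  exists A, is_circular_arc (vec3 0 0 k^-1) u A /\
  forall x, A x -> [\/ x = vec3 0 0 k^-1, x = u |
    [/\ 0 < k * x 0 i2, pencil k x &
      exists2 s, 0 < s & x 0 i0 = s * u 0 i0 /\ x 0 i1 = s * u 0 i1]].
Proof.
move=> k0 u2 u1; set h := pencil_height k; pose sg : R := Num.sg k.
have sg2 : sg * sg = 1 by rewrite -expr2 sqr_sg k0.
have sgk : 0 < sg * k by rewrite -normrEsg normr_gt0.
pose r : R := sg * ((1 + k ^+ 2) / (2 * k)).
have r0 : 0 < r.
  rewrite /r; have -> : sg * ((1 + k ^+ 2) / (2 * k)) = (sg * k) * (1 + k ^+ 2) / (2 * k ^+ 2) by field.
  have k2 : 0 < k ^+ 2 by rewrite exprn_even_gt0.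
  by apply: divr_gt0; apply: mulr_gt0 => //; rewrite addr_gt0.
have r2 : r ^+ 2 = 1 + h ^+ 2.
  by rewrite /r exprMn expr2 sg2 /h /pencil_height; field.
have hr : h ^+ 2 < r ^+ 2 by rewrite r2; lra.
(* The cosine at which the height [h + r * sg * cos t] of the meridian reaches 0. *)
pose q := - (sg * h) / r.
have q2 : q ^+ 2 = h ^+ 2 / r ^+ 2.
  by rewrite /q expr_div_n sqrrN exprMn (expr2 sg) sg2 mul1r.
have q21 : q ^+ 2 < 1 by rewrite q2 ltr_pdivrMr ?exprn_gt0 // mul1r.
have q1 : -1 < q < 1 by apply/andP; split; nra.
have q1' : -1 <= q <= 1 by case/andP: q1 => *; rewrite !ltW.
pose th := acos q.
have cth : cos th = q by rewrite acosK // in_itv.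
have th0 : 0 < th by apply: acos_gt0; case/andP: q1 => *; rewrite ltW.
have thpi : th < pi by apply: acos_ltpi; case/andP: q1 => *; rewrite ltW ?andbT.
have sth : r * sin th = 1.
  rewrite sin_acos // -[r]gtr0_norm // -sqrtr_sqr -sqrtrM ?sqr_ge0 //.
  by rewrite q2 mulrBr mulr1 mulrC divfK ?r2 ?addrK ?sqrtr1 // -r2 expf_neq0 // gt_eqF.
pose e1 : 'rV[R]_3 := vec3 0 0 sg; pose e2 : 'rV[R]_3 := u.
have pt t : circle_point (vec3 0 0 h) e1 e2 r t =
    vec3 (r * sin t * u 0 i0) (r * sin t * u 0 i1) (h + r * sg * cos t).
  by apply: vec3P; rewrite !mxE /= ?u2; ring.
have rq : r * sg * q = - h.
  by rewrite /q; have -> : r * sg * (- (sg * h) / r) = - (sg * sg * h); [field; rewrite gt_eqF | rewrite sg2 mul1r].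
have Tpt : circle_point (vec3 0 0 h) e1 e2 r 0 = vec3 0 0 k^-1.
  rewrite pt sin0 cos0; apply: vec3P; rewrite !vec3E; [ring|ring|].
  have -> : r * sg * 1 = (sg * sg) * ((1 + k ^+ 2) / (2 * k)) by rewrite /r; ring.
  by rewrite sg2 /h /pencil_height; field.
have Upt : circle_point (vec3 0 0 h) e1 e2 r th = u.
  by rewrite pt sth cth rq; apply: vec3P; rewrite !vec3E ?u2; ring.
exists [set circle_point (vec3 0 0 h) e1 e2 r t | t in [set t | 0 <= t <= th]]; split.
  exists (vec3 0 0 h), e1, e2, r, th; split=> //.
  - have d1 : dot e1 e1 = 1 by rewrite dot3E !vec3E; lra.
    have d2 : dot e2 e2 = 1 by rewrite dot3E u2; lra.
    by have d3 : dot e1 e2 = 0 by rewrite dot3E !vec3E u2; lra.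
  - by rewrite th0; lra.
move=> _ [t /= /andP[t0 t1] <-].
have [->|tn0] := eqVneq t 0; first by constructor 1.
have [->|tn1] := eqVneq t th; first by constructor 2.
have {t0}t0 : 0 < t by rewrite lt_def tn0.
have {t1}t1 : t < th by rewrite lt_neqAle tn1.
have st : 0 < sin t by apply: sin_gt0_pi; rewrite t0 (lt_trans t1).
constructor 3; rewrite pt; split.
- have tI : t \in `[0, pi] by rewrite in_itv /= !ltW // (lt_trans t1).
  have thI : th \in `[0, pi] by rewrite in_itv /= !ltW.
  have ct : q < cos t by rewrite -cth (ltr_cos tI thI).
  rewrite vec3E; have -> : h + r * sg * cos t = r * sg * (cos t - q) by rewrite mulrBr rq; ring.
  have -> : k * (r * sg * (cos t - q)) = r * (sg * k) * (cos t - q) by ring.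
  by rewrite pmulr_rgt0 ?subr_gt0 // pmulr_rgt0.
- rewrite /pencil /= !vec3E -/h.
  have -> : (r * sin t * u 0 i0) ^+ 2 + (r * sin t * u 0 i1) ^+ 2 =
    (r * sin t) ^+ 2 * (u 0 i0 ^+ 2 + u 0 i1 ^+ 2) by ring.
  rewrite u1 mulr1.
  have E : (r * sg * cos t) ^+ 2 = r ^+ 2 * cos t ^+ 2.
    by rewrite !exprMn (expr2 sg) sg2 mulr1.
  have E2 : r ^+ 2 * sin t ^+ 2 + r ^+ 2 * cos t ^+ 2 = 1 + h ^+ 2.
    by rewrite -mulrDr addrC cos2Dsin2 mulr1 r2.
  by move: (r * sg * cos t) E => w E; rewrite exprMn; lra.
- by exists (r * sin t); [exact: mulr_gt0 | rewrite !vec3E].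
Qed.

(** The arc lies in the plane through [u], [v] and the pole at height [- k], opposite to the cap.
    Projection from this pole divides the horizontal coordinates by [s = 1 + z / k], where [z] is
    the height, and sends the arc to the chord, [l] being the position there. *)
Lemma chord_arc k u v : k != 0 -> u != v -> u 0 i2 = 0 -> v 0 i2 = 0 ->
  u 0 i0 ^+ 2 + u 0 i1 ^+ 2 = 1 -> v 0 i0 ^+ 2 + v 0 i1 ^+ 2 = 1 ->
  exists A, is_circular_arc u v A /\
  forall x, A x -> [\/ x = u, x = v |
    [/\ 0 < k * x 0 i2, pencil k x &
      exists s l, [/\ 0 < l < 1, s != 0, s = 1 + x 0 i2 / k,
        x 0 i0 = s * (l * u 0 i0 + (1 - l) * v 0 i0) &
        x 0 i1 = s * (l * u 0 i1 + (1 - l) * v 0 i1)]]].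
Proof.
move=> k0 uv u2 v2 u1 v1; set h := pencil_height k.
pose m0 := (u 0 i0 + v 0 i0) / 2; pose m1 := (u 0 i1 + v 0 i1) / 2.
pose d0 := (v 0 i0 - u 0 i0) / 2; pose d1 := (v 0 i1 - u 0 i1) / 2.
have L2gt : 0 < d0 ^+ 2 + d1 ^+ 2.
  rewrite lt_def addr_ge0 ?sqr_ge0 // andbT paddr_eq0 ?sqr_ge0 // !sqrf_eq0.
  apply: contra uv => /andP[/eqP e0 /eqP e1]; apply/eqP/vec3P.
  - by rewrite /d0 in e0; lra.
  - by rewrite /d1 in e1; lra.
  - by rewrite u2 v2.
pose L := Num.sqrt (d0 ^+ 2 + d1 ^+ 2).
have L0 : 0 < L by rewrite sqrtr_gt0.
have L2 : L ^+ 2 = d0 ^+ 2 + d1 ^+ 2 by rewrite sqr_sqrtr // ltW.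
have mL : m0 ^+ 2 + m1 ^+ 2 + L ^+ 2 = 1 by rewrite L2 /m0 /m1 /d0 /d1; lra.
have md : m0 * d0 + m1 * d1 = 0 by rewrite /m0 /m1 /d0 /d1; lra.
have D2gt : 0 < m0 ^+ 2 + m1 ^+ 2 + k ^+ 2.
  by rewrite ltr_wpDl ?addr_ge0 ?sqr_ge0 // exprn_even_gt0.
pose D := Num.sqrt (m0 ^+ 2 + m1 ^+ 2 + k ^+ 2).
have D0 : 0 < D by rewrite sqrtr_gt0.
have D2 : D ^+ 2 = m0 ^+ 2 + m1 ^+ 2 + k ^+ 2 by rewrite sqr_sqrtr // ltW.
have Dn : D != 0 by rewrite gt_eqF.
have Ln : L != 0 by rewrite gt_eqF.
(* The diameter through the chord's midpoint starts at the pole, at distance [D]; by the power of a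
   point its other part is [L ^+ 2 / D]. [ca] is the signed distance of the centre from the
   midpoint. *)
pose r : R := (L ^+ 2 / D + D) / 2; pose ca : R := (L ^+ 2 / D - D) / 2.
have LD : 0 < L ^+ 2 / D by rewrite divr_gt0 // exprn_gt0.
have r0 : 0 < r by rewrite /r; lra.
have rca : r ^+ 2 - ca ^+ 2 = L ^+ 2 by rewrite /r /ca; field.
pose q : R := - ca / r.
have q1 : -1 < q < 1.
  by rewrite /q ltr_pdivlMr // ltr_pdivrMr // /r /ca; apply/andP; split; lra.
have q1' : -1 <= q <= 1 by case/andP: q1 => *; rewrite !ltW.
pose n := acos q.
have cn : cos n = q by rewrite acosK // in_itv.
have n0 : 0 < n by apply: acos_gt0; case/andP: q1 => *; rewrite ltW.
have npi : n < pi by apply: acos_ltpi; case/andP: q1 => *; rewrite ltW ?andbT.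
have nI : 0 < n < pi by rewrite n0.
have rc : r * cos n = - ca by rewrite cn /q; field; rewrite gt_eqF.
have sn : 0 < sin n by apply: sin_gt0_pi.
have rsin : r * sin n = L.
  have p0 : 0 <= r * sin n by apply: mulr_ge0; exact: ltW.
  apply/eqP; rewrite -(eqrXn2 (n := 2)) //; last exact: ltW.
  by rewrite exprMn sin2cos2 mulrBr mulr1 -exprMn rc sqrrN rca.
pose f1 : 'rV[R]_3 := vec3 (m0 / D) (m1 / D) (k / D).
pose f2 : 'rV[R]_3 := vec3 (d0 / L) (d1 / L) 0.
pose cc : 'rV[R]_3 := vec3 m0 m1 0 + ca *: f1.
pose e1 := cos n *: f1 - sin n *: f2; pose e2 := sin n *: f1 + cos n *: f2.
pose a t : R := ca + r * cos (t - n); pose b t : R := r * sin (t - n).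
have pt t : circle_point cc e1 e2 r t = vec3 m0 m1 0 + a t *: f1 + b t *: f2.
  by apply: vec3P; rewrite /a /b cosB sinB !mxE /=; ring.
have ab t : (a t - ca) ^+ 2 + b t ^+ 2 = r ^+ 2.
  have E := cos2Dsin2 (t - n).
  by rewrite /a /b addrAC subrr add0r !exprMn -mulrDr E mulr1.
have upt : circle_point cc e1 e2 r 0 = u.
  rewrite pt /a /b sub0r cosN sinN mulrN rc rsin subrr scale0r addr0.
  apply: vec3P; rewrite !mxE /= ?u2 /m0 /m1 /d0 /d1; [field; exact: Ln | field; exact: Ln | ring].
have vpt : circle_point cc e1 e2 r (n * 2) = v.
  rewrite pt /a /b (_ : n * 2 - n = n); last by ring.
  rewrite rc rsin subrr scale0r addr0.
  apply: vec3P; rewrite !mxE /= ?v2 /m0 /m1 /d0 /d1; [field; exact: Ln | field; exact: Ln | ring].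
exists [set circle_point cc e1 e2 r t | t in [set t | 0 <= t <= n * 2]]; split.
  exists cc, e1, e2, r, (n * 2); split=> //; last by apply/andP; split; lra.
  have f11 : dot f1 f1 = 1.
    have : dot f1 f1 = (m0 ^+ 2 + m1 ^+ 2 + k ^+ 2) / D ^+ 2 by rewrite dot3E !vec3E; field.
    by rewrite -D2 divff // expf_neq0.
  have f22 : dot f2 f2 = 1.
    have : dot f2 f2 = (d0 ^+ 2 + d1 ^+ 2) / L ^+ 2 by rewrite dot3E !vec3E; field.
    by rewrite -L2 divff // expf_neq0.
  have f12 : dot f1 f2 = 0.
    rewrite dot3E !vec3E; have -> : m0 / D * (d0 / L) + m1 / D * (d1 / L) + k / D * 0 =
      (m0 * d0 + m1 * d1) / (D * L) by field; rewrite Dn Ln.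
    by rewrite md mul0r.
  have cs := cos2Dsin2 n.
  have g1 : dot e1 e1 = 1 by rewrite /e1 !dotE f11 f22 (dotC f2) f12; lra.
  have g2 : dot e2 e2 = 1 by rewrite /e2 !dotE f11 f22 (dotC f2) f12; lra.
  by have g3 : dot e1 e2 = 0 by rewrite /e1 /e2 !dotE f11 f22 (dotC f2) f12; lra.
move=> _ [t /= /andP[t0 t1] <-].
have [->|tn0] := eqVneq t 0; first by constructor 1.
have [->|tn1] := eqVneq t (n * 2); first by constructor 2.
have tI : 0 < t < n * 2 by rewrite !lt_def tn0 t0 t1 eq_sym tn1.
have at0 : 0 < a t.
  have := cos_gt_arc nI tI; rewrite -(ltr_pM2l r0) rc /a => ?; lra.
have abE : a t ^+ 2 + b t ^+ 2 = L ^+ 2 + a t * (L ^+ 2 / D - D).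
  by have := ab t; have := rca; rewrite /ca => e1' e2'; lra.
constructor 3; rewrite pt; move: (a t) (b t) at0 abE => a' b' a0 abE.
have s0 : 0 < 1 + a' / D by rewrite addr_gt0 // divr_gt0.
split.
- rewrite !mxE /=; have -> : k * (0 + a' * (k / D) + b' * 0) = k ^+ 2 * a' / D by field.
  by apply: divr_gt0 => //; apply: mulr_gt0 => //; rewrite exprn_even_gt0.
- rewrite /pencil /= -/h !mxE /=.
  have -> : (m0 + a' * (m0 / D) + b' * (d0 / L)) ^+ 2 + (m1 + a' * (m1 / D) + b' * (d1 / L)) ^+ 2
      + (0 + a' * (k / D) + b' * 0) ^+ 2 =
    (m0 ^+ 2 + m1 ^+ 2) * (1 + 2 * a' / D) + a' ^+ 2 * ((m0 ^+ 2 + m1 ^+ 2 + k ^+ 2) / D ^+ 2)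
    + b' ^+ 2 * ((d0 ^+ 2 + d1 ^+ 2) / L ^+ 2) + 2 * (1 + a' / D) * b' / L * (m0 * d0 + m1 * d1).
    by field; rewrite Dn Ln.
  rewrite md -D2 -L2 !divff ?expf_neq0 // mulr0 addr0 !mulr1 /h /pencil_height.
  have -> : 2 * ((1 - k ^+ 2) / (2 * k)) * (0 + a' * (k / D) + b' * 0) =
    (1 - k ^+ 2) * (a' / D) by field; rewrite k0 Dn.
  have -> : m0 ^+ 2 + m1 ^+ 2 = 1 - L ^+ 2 by lra.
  have E : b' ^+ 2 = L ^+ 2 + a' * (L ^+ 2 / D - D) - a' ^+ 2 by lra.
  have k2 : k ^+ 2 = D ^+ 2 + L ^+ 2 - 1 by lra.
  by rewrite E k2; field.
(* Along the chord the projected point is [b' / (L s)] half-lengths from the midpoint, so [bs] below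
   keeps it strictly between the ends. *)
exists (1 + a' / D), (1 / 2 - b' / (2 * L * (1 + a' / D))).
have sn0 : 1 + a' / D != 0 by rewrite gt_eqF.
have bs : b' ^+ 2 < (L * (1 + a' / D)) ^+ 2.
  have -> : (L * (1 + a' / D)) ^+ 2 = b' ^+ 2 + (L ^+ 2 * (a' / D) + (L * (a' / D)) ^+ 2 + D * a' + a' ^+ 2).
    have E : b' ^+ 2 = L ^+ 2 + a' * (L ^+ 2 / D - D) - a' ^+ 2 by lra.
    by rewrite E; field.
  have aD : 0 < a' / D by exact: divr_gt0.
  rewrite ltrDl; do 3?[apply: addr_gt0]; do ?[exact: exprn_gt0 | apply: exprn_gt0 | apply: mulr_gt0 => //].
have u0E : u 0 i0 = m0 - d0 by rewrite /m0 /d0; lra.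
have u1E : u 0 i1 = m1 - d1 by rewrite /m1 /d1; lra.
have v0E : v 0 i0 = m0 + d0 by rewrite /m0 /d0; lra.
have v1E : v 0 i1 = m1 + d1 by rewrite /m1 /d1; lra.
split=> //.
- have : 0 < L * (1 + a' / D) by rewrite mulr_gt0.
  have -> : b' / (2 * L * (1 + a' / D)) = b' / (L * (1 + a' / D)) / 2.
    by rewrite -mulrA invfM mulrCA mulrC.
  move: (L * (1 + a' / D)) bs => w bs w0.
  have h1 : -1 < b' / w by rewrite ltr_pdivlMr // mulN1r; nra.
  have h2 : b' / w < 1 by rewrite ltr_pdivrMr // mul1r; nra.
  by apply/andP; split; lra.
- by rewrite !mxE /=; field; rewrite k0 Dn.
- rewrite u0E v0E !mxE /=.
  have -> : m0 + a' * (m0 / D) + b' * (d0 / L) = (1 + a' / D) * m0 + b' / L * d0 by ring.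
  by move: (1 + a' / D) sn0 => w wn; field; rewrite wn Ln.
- rewrite u1E v1E !mxE /=.
  have -> : m1 + a' * (m1 / D) + b' * (d1 / L) = (1 + a' / D) * m1 + b' / L * d1 by ring.
  by move: (1 + a' / D) sn0 => w wn; field; rewrite wn Ln.
Qed.
End PencilArcs.

(** * Drawings of complete bipartite and complete graphs *)

Section Coverings.
Variable R : realType.

(* Pages [2 i] and [2 i + 1] are the two caps of sphere [i]. *)
Definition page (s : nat) : R := if odd s then - (s./2.+1%:R)^-1 else s./2.+1%:R.

Lemma page_neq0 s : page s != 0.
Proof. by rewrite /page; case: odd; rewrite ?oppr_eq0 ?invr_eq0 pnatr_eq0. Qed.

Lemma page_inj : injective page.
Proof.
have pos s : 0 < (s./2.+1%:R : R) by rewrite ltr0n.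
have half s t : (s./2.+1%:R : R) = t./2.+1%:R -> odd s = odd t -> s = t.
  move=> /eqP; rewrite eqr_nat eqSS => /eqP h o.
  by rewrite -(odd_double_half s) -(odd_double_half t) h o.
move=> s t; rewrite /page; case os: (odd s); case ot: (odd t).
- by move=> /oppr_inj /invr_inj /half; apply; rewrite os.
- move=> E; have := pos t; rewrite -E oppr_gt0 invr_lt0 => h.
  by have := lt_trans h (pos s); rewrite ltxx.
- move=> E; have := pos s; rewrite E oppr_gt0 invr_lt0 => h.
  by have := lt_trans h (pos t); rewrite ltxx.
- by move=> /half; apply; rewrite os.
Qed.

Lemma pencil_page s : pencil (page s) = pencil (s./2.+1%:R : R).
Proof.
rewrite /page; case: odd => //.
by rewrite /pencil pencil_heightV // pnatr_eq0.
Qed.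

Lemma pole_pencil k : k != 0 -> pencil k (vec3 0 0 k^-1 : 'rV[R]_3).
Proof. by move=> k0; rewrite /pencil /= !vec3E /pencil_height; field. Qed.

(** Each sphere serves two of the [p] vertices, one at each pole. A point of an open meridian
    determines its cap, then its distance from the axis, then its direction, hence the edge. *)
Lemma coverable_bipartite p q : (1 <= p)%N ->
  coverable R 2 3 (complete_bipartite_graph p q) (uphalf p).
Proof.
move=> p1; pose G := complete_bipartite_graph p q.
pose S (i : 'I_(uphalf p)) : set 'rV[R]_3 := pencil (i.+1%:R).
pose pos (x : G) : 'rV[R]_3 :=
  match x with inl i => vec3 0 0 (page i)^-1 | inr j => circ j%:R end.
pose I (e : {set G}) : set 'rV[R]_3 := [set x : 'rV[R]_3 | exists (i : 'I_p) (j : 'I_q),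
  e = [set (inl i : G); inr j]%SET /\ [/\ 0 < page i * x 0 i2, pencil (page i) x &
    exists2 s, 0 < s & x 0 i0 = s * circ (j%:R : R) 0 i0 /\ x 0 i1 = s * circ (j%:R : R) 0 i1]].
have page_on (i : 'I_p) x : pencil (page i) x -> exists l, S l x.
  move=> px; have ip : (i./2 < uphalf p)%N by have := ltn_ord i; lia.
  by exists (Ordinal ip); rewrite /S /= -pencil_page.
have natr_ord_inj m : injective (fun j : 'I_m => j%:R : R).
  by move=> j j' /eqP; rewrite eqr_nat => /eqP /val_inj.
apply: (@coverable_from R G _ S pos I).
- by move=> i; exact: is_sphere_pencil.
- move=> [i|j] [i'|j'] /= E.
  + congr inl; apply/val_inj/page_inj/invr_inj.
    by have := congr1 (fun x : 'rV[R]_3 => x 0 i2) E; rewrite /= !vec3E.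
  + have := congr1 (fun x : 'rV[R]_3 => x 0 i2) E; rewrite /= circ2 !vec3E => /eqP.
    by rewrite invr_eq0 (negPf (page_neq0 _)).
  + have := congr1 (fun x : 'rV[R]_3 => x 0 i2) E; rewrite /= circ2 !vec3E => /esym /eqP.
    by rewrite invr_eq0 (negPf (page_neq0 _)).
  + by move: E => /circ_inj /natr_ord_inj ->.
- move=> [i|j]; first exact: (page_on i _ (pole_pencil (page_neq0 i))).
  have p0 : (0 < uphalf p)%N by lia.
  by exists (Ordinal p0); exact: circ_pencil.
- move=> e /edgesP [u [v [uv eE]]].
  suff H (i : 'I_p) (j : 'I_q) : e = [set (inl i : G); inr j]%SET -> exists u v A,
      [/\ e = [set u; v]%SET, adj u v, is_circular_arc (pos u) (pos v) A &
        forall x, A x -> [\/ x = pos u, x = pos v | I e x]].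
    move: u v uv eE => [i|j] [i'|j'] //= _ E; first exact: (H i j').
    by apply: (H i' j); rewrite E finset.setUC.
  move=> eij.
  have [A [arcA hA]] := meridian_arc (page_neq0 i) (circ2 (j%:R : R)) (circ_unit _).
  exists (inl i), (inr j), A; split=> // x /hA [->|->|H]; [by constructor 1|by constructor 2|].
  by constructor 3; exists i, j.
- move=> e x _ [i [j [_ [x2 px [s s0 [e0 e1]]]]]]; split; first exact: page_on px.
  move=> [i'|j'] /=; apply/eqP => E.
    have : x 0 i0 ^+ 2 + x 0 i1 ^+ 2 = s ^+ 2.
      by rewrite e0 e1 !exprMn -mulrDr circ_unit mulr1.
    rewrite E !vec3E expr0n addr0 => /esym /eqP.
    by rewrite sqrf_eq0 gt_eqF.
  by move: x2; rewrite E circ2 mulr0 ltxx.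
- move=> e f x _ _ [i [j [-> [x2 px [s s0 [e0 e1]]]]]] [i' [j' [-> [x2' px' [s' s0' [e0' e1']]]]]].
  have /page_inj /val_inj -> := pencil_inj x2 x2' px px'.
  (* Both are the distance of [x] from the axis. *)
  have ss : s = s'.
    apply/eqP; rewrite -(eqrXn2 (n := 2)) //; try exact: ltW.
    have h : x 0 i0 ^+ 2 + x 0 i1 ^+ 2 = s ^+ 2 by rewrite e0 e1 !exprMn -mulrDr circ_unit mulr1.
    have h' : x 0 i0 ^+ 2 + x 0 i1 ^+ 2 = s' ^+ 2 by rewrite e0' e1' !exprMn -mulrDr circ_unit mulr1.
    by rewrite -h h'.
  have sn : s != 0 by rewrite gt_eqF.
  suff /circ_inj /natr_ord_inj -> : circ (j%:R : R) = circ j'%:R by [].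
  apply: vec3P; rewrite ?circ2 //; apply: (mulfI sn).
    by rewrite -e0 ss.
  by rewrite -e1 ss.
Qed.

(** The side of the line through [circ a] and [circ b] on which [circ s] lies is given by the sign
    of [(s - a) * (s - b)]. If [c] and [d] are not strictly separated, a point strictly between them
    is on that line only if both are. *)
Lemma chords_cross (a b c d l t : R) : 0 < t < 1 ->
  0 <= ((c - a) * (c - b)) * ((d - a) * (d - b)) ->
  l * circ a 0 i0 + (1 - l) * circ b 0 i0 = t * circ c 0 i0 + (1 - t) * circ d 0 i0 ->
  l * circ a 0 i1 + (1 - l) * circ b 0 i1 = t * circ c 0 i1 + (1 - t) * circ d 0 i1 ->
  (c - a) * (c - b) = 0 /\ (d - a) * (d - b) = 0.
Proof.
move=> /andP[t0 t1] CD E0 E1.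
(* The line through [circ a] and [circ b] is [ell = 0]. *)
pose ell x y := (1 - a * b) * x + (a + b) * y - (1 + a * b).
have ellE s : ell (circ s 0 i0) (circ s 0 i1) = - 2 * ((s - a) * (s - b)) / (1 + s ^+ 2).
  by rewrite /ell !vec3E; field; exact: circ_denom.
have conv (r x y x' y' : R) : ell (r * x + (1 - r) * x') (r * y + (1 - r) * y') =
    r * ell x y + (1 - r) * ell x' y' by rewrite /ell; ring.
have pos s : 0 < 1 + s ^+ 2 :> R by rewrite ltr_pwDl ?sqr_ge0.
have : t * ell (circ c 0 i0) (circ c 0 i1) + (1 - t) * ell (circ d 0 i0) (circ d 0 i1) = 0.
  by rewrite -conv -E0 -E1 conv !ellE !subrr !(mul0r, mulr0) addr0.
rewrite !ellE; set C := (c - a) * (c - b) in CD *; set D := (d - a) * (d - b) in CD *.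
have wc : 0 < t / (1 + c ^+ 2) by rewrite divr_gt0.
have wd : 0 < (1 - t) / (1 + d ^+ 2) by rewrite divr_gt0 // subr_gt0.
have -> : t * (-2 * C / (1 + c ^+ 2)) + (1 - t) * (-2 * D / (1 + d ^+ 2)) =
  -2 * (t / (1 + c ^+ 2) * C + (1 - t) / (1 + d ^+ 2) * D) by field; rewrite !gt_eqF.
move: (t / _) ((1 - t) / _) wc wd => p q p0 q0 /eqP.
rewrite mulf_eq0 oppr_eq0 pnatr_eq0 /= => /eqP E.
have C0 : C = 0.
  have h : p * C ^+ 2 + q * (C * D) = 0 by rewrite -[RHS](mulr0 C) -E; ring.
  have h2 : 0 <= q * (C * D) by rewrite mulr_ge0 // ltW.
  have h3 : 0 <= p * C ^+ 2 by rewrite mulr_ge0 ?sqr_ge0 // ltW.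
  have : p * C ^+ 2 = 0 by lra.
  by move/eqP; rewrite mulf_eq0 gt_eqF //= sqrf_eq0 => /eqP.
split=> //; move: E; rewrite C0 mulr0 add0r => /eqP.
by rewrite mulf_eq0 gt_eqF //= => /eqP.
Qed.

(* Two edges on the same page have their sums in [{2k, 2k+1}] modulo [n]; if
   [i < i' < j < j'] crossed, the sums would differ by at least [2] and at most [n - 2]. *)
Lemma same_page_cross n i i' j j' : (i < i')%N -> (i' < j)%N -> (j < j')%N -> (j' < n)%N ->
  ((i + j) %% n)./2 <> ((i' + j') %% n)./2.
Proof.
move=> h1 h2 h3 h4.
have modE x : (x < 2 * n)%N -> (x %% n = if x < n then x else x - n)%N.
  move=> x2; case: ltnP => xn; first by rewrite modn_small.
  by rewrite -{1}(subnK xn) modnDr modn_small //; lia.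
by rewrite !modE; [case: ltnP => ?; case: ltnP => ?; lia | lia | lia].
Qed.

(** After sorting each pair, only the interleavings [k < i < l < j] and [i < k < j < l] give a
    negative product, and [same_page_cross] excludes them. *)
Lemma same_page_noncrossing n i j k l : (i < n)%N -> (j < n)%N -> (k < n)%N -> (l < n)%N ->
  ((i + j) %% n)./2 = ((k + l) %% n)./2 ->
  0 <= ((k%:R - i%:R) * (k%:R - j%:R)) * ((l%:R - i%:R) * (l%:R - j%:R)) :> R.
Proof.
move=> hi hj hk hl.
wlog ij : i j hi hj / (i <= j)%N.
  move=> H; have [ij|/ltnW ji] := leqP i j; first exact: H.
  rewrite [(k%:R - i%:R) * _]mulrC [(l%:R - i%:R) * _]mulrC => E.
  by apply: H; rewrite // (addnC j).
wlog kl : k l hk hl / (k <= l)%N.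
  move=> H; have [kl|/ltnW lk] := leqP k l; first exact: H.
  by rewrite mulrC => E; apply: H; rewrite // (addnC l).
have sub (x y : nat) : (x <= y)%N -> 0 <= y%:R - x%:R :> R by rewrite subr_ge0 ler_nat.
have sub' (x y : nat) : (x <= y)%N -> x%:R - y%:R <= 0 :> R by rewrite subr_le0 ler_nat.
have inside x : (i <= x)%N -> (x <= j)%N -> (x%:R - i%:R) * (x%:R - j%:R) <= 0 :> R.
  by move=> /sub h1 /sub' h2; exact: mulr_ge0_le0.
have outside x : (x <= i)%N || (j <= x)%N -> 0 <= (x%:R - i%:R) * (x%:R - j%:R) :> R.
  case/orP => h; first by apply: mulr_le0; apply: sub' => //; exact: leq_trans ij.
  by apply: mulr_ge0; apply: sub => //; exact: leq_trans h.
move=> same.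
have [ki|ki] := leqP k i.
  have [li|li] := leqP l i; first by rewrite mulr_ge0 // outside ?ki ?li.
  have [jl|jl] := leqP j l; first by rewrite mulr_ge0 // outside ?ki ?jl ?orbT.
  have [E|ne] := eqVneq k i; first by rewrite E subrr !mul0r.
  have ki' : (k < i)%N by rewrite ltn_neqAle ne.
  by case: (same_page_cross ki' li jl hj); rewrite same.
have [jk|jk] := leqP j k.
  by rewrite mulr_ge0 // outside ?jk ?orbT // (leq_trans jk) ?orbT.
have [lj|lj] := leqP l j.
  by rewrite mulr_le0 // inside // ltnW // (leq_trans ki).
by case: (same_page_cross ki jk lj hl).
Qed.

(** The edge [ij] goes on page [((i + j) %% n)./2]: in a regular polygon, edges with equal sum
    modulo [n] are parallel, and two consecutive sums form a zigzag. *)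
Lemma coverable_complete n : (1 <= n)%N ->
  coverable R 2 3 (complete_graph n) ((n + 3) %/ 4).
Proof.
move=> n1; pose G := complete_graph n.
pose K := ((n + 3) %/ 4)%N.
pose S (i : 'I_K) : set 'rV[R]_3 := pencil (i.+1%:R).
pose pos (i : G) : 'rV[R]_3 := circ (i : 'I_n)%:R.
pose pg (i j : 'I_n) : R := page ((i + j) %% n)./2.
pose I (e : {set G}) : set 'rV[R]_3 := [set x : 'rV[R]_3 | exists i j : 'I_n,
  e = [set (i : G); (j : G)]%SET /\ [/\ 0 < pg i j * x 0 i2, pencil (pg i j) x &
    exists s l, [/\ 0 < l < 1, s != 0, s = 1 + x 0 i2 / pg i j,
      x 0 i0 = s * (l * pos i 0 i0 + (1 - l) * pos j 0 i0) &
      x 0 i1 = s * (l * pos i 0 i1 + (1 - l) * pos j 0 i1)]]].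
have natr_ord_inj : injective (fun j : 'I_n => j%:R : R).
  by move=> j j' /eqP; rewrite eqr_nat => /eqP /val_inj.
have pos_inj : injective pos by move=> i j /circ_inj /natr_ord_inj.
apply: (@coverable_from R G _ S pos I).
- by move=> i; exact: is_sphere_pencil.
- exact: pos_inj.
- move=> v; have K0 : (0 < K)%N by rewrite /K; lia.
  by exists (Ordinal K0); exact: circ_pencil.
- move=> e /edgesP [u [v [uv eE]]].
  have ne : pos u != pos v by rewrite (inj_eq pos_inj) adj_neq.
  have [A [arcA hA]] := chord_arc (page_neq0 ((u + v) %% n)./2) ne
    (circ2 _) (circ2 _) (circ_unit _) (circ_unit _).
  exists u, v, A; split=> // x /hA [->|->|H]; [by constructor 1|by constructor 2|].
  by constructor 3; exists u, v.
- move=> e x _ [i [j [_ [x2 px _]]]]; split.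
    have lt : (((i + j) %% n)./2./2 < K)%N.
      by have := ltn_pmod (i + j) n1; rewrite /K; lia.
    by exists (Ordinal lt); rewrite /S /= -pencil_page.
  move=> w; apply/eqP => E.
  by move: x2; rewrite E circ2 mulr0 ltxx.
move=> e f x eG fG [i [j [eE [x2 px [s [l [lI sn sE e0 e1]]]]]]].
move=> [i' [j' [fE [x2' px' [s' [t [tI _ sE' e0' e1']]]]]]].
have pgE := pencil_inj x2 x2' px px'.
have ss : s' = s by rewrite sE sE' pgE.
rewrite ss in e0' e1'.
(* On one page [s] depends only on the height of [x], so the two projections to the chords are the
   same point. *)
have E0 := mulfI sn (etrans (esym e0) e0'); have E1 := mulfI sn (etrans (esym e1) e1').
have same := page_inj pgE.
have nc := same_page_noncrossing (ltn_ord i) (ltn_ord j) (ltn_ord i') (ltn_ord j') same.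
have [h1 h2] := chords_cross tI nc E0 E1.
have mem (w : 'I_n) : (w%:R - i%:R) * (w%:R - j%:R) = 0 :> R -> (w == i) || (w == j).
  move/eqP; rewrite mulf_eq0 !subr_eq0 => /orP[] /eqP /natr_ord_inj ->; by rewrite eqxx ?orbT.
have ne' : i' != j'.
  have [u [v [uv E]]] := edgesP fG; apply/eqP => E'; rewrite fE E' in E.
  have := adj_neq uv; have := set21 u v; have := set22 u v; rewrite -E !inE.
  by move=> /orP[] /eqP -> /orP[] /eqP ->; rewrite eqxx.
rewrite eE fE; move: (mem _ h1) (mem _ h2) ne' => /orP[] /eqP -> /orP[] /eqP ->; rewrite ?eqxx // => _.
by rewrite finset.setUC.
Qed.
End Coverings.

(** * Edge counts and the cover numbers *)

Lemma card_edges_complete n : (n * (n - 1) <= 2 * #|edges (complete_graph n)|)%N.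
Proof.
have : (#|[set A : {set 'I_n} | #|A| == 2]%SET| <= #|edges (complete_graph n)|)%N.
  apply: subset_leq_card; apply/fintype.subsetP => A; rewrite !inE => /cards2P [u [v [uv ->]]].
  by apply/existsP; exists u; apply/existsP; exists v; apply/andP; split.
rewrite card_draws card_ord bin2; case: n => [|n] //=.
rewrite subn1 /= => h; apply: leq_trans (_ : 2 * (n.+1 * n)./2 <= _)%N; last by rewrite leq_mul2l.
have : ~~ odd (n.+1 * n) by rewrite oddM /= andNb.
lia.
Qed.

Lemma card_edges_bipartite p q : (p * q <= #|edges (complete_bipartite_graph p q)|)%N.
Proof.
pose G := complete_bipartite_graph p q.
pose f (u : 'I_p * 'I_q) : {set G} := [set (inl u.1 : G); inr u.2]%SET.
have f_inj : injective f.
  move=> [i j] [i' j'] E; have h1 : (inl i : G) \in f (i', j') by rewrite -E !inE eqxx.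
  have h2 : (inr j : G) \in f (i', j') by rewrite -E !inE eqxx orbT.
  by move: h1 h2; rewrite !inE orbF /= => /eqP [->] /eqP [->].
have := card_imset [set: 'I_p * 'I_q]%SET f_inj; rewrite cardsT card_prod !card_ord => <-.
apply: subset_leq_card; apply/fintype.subsetP => e /imsetP [[i j] _ ->].
by apply: adj_edge.
Qed.

Lemma spherical_cover_number_exists (R : realType) (G : graph) k :
  coverable R 2 3 G k -> exists2 s, spherical_cover_number R 2 3 G s & (s <= k)%N.
Proof.
move=> ck; have exP : exists s, `[< coverable R 2 3 G s >] by exists k; apply/asboolP.
have [s /asboolP cs smin] := ex_minnP exP.
exists s; last by apply: smin; apply/asboolP.
by split=> // l cl; apply: smin; apply/asboolP.
Qed.

Lemma coverable_gt0 (R : realType) (G : graph) (v : G) k : coverable R 2 3 G k -> (0 < k)%N.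
Proof. by move=> [S [_ [D [_ [/(_ v) [i _ _] _]]]]]; case: k S D i => // S D []. Qed.

Theorem theorem1 (R : realType) :
  (forall n : nat, (3 <= n)%N ->
     exists s : nat,
       spherical_cover_number R 2 3 (complete_graph n) s /\
       Num.floor ((n%:R + 7) / 6 : R) <= s%:Z <= Num.ceil (n%:R / 4 : R))
  /\
  (forall p q : nat, (1 <= p)%N -> (p <= q)%N ->
     exists s : nat,
       [/\ spherical_cover_number R 2 3 (complete_bipartite_graph p q) s,
           (p, q) <> (1%N, 1%N) ->
             (p%:R * q%:R) / (2 * p%:R + 2 * q%:R - 4) <= s%:R :> R,
           (s <= p)%N &
           (p * (p - 1) < q)%N -> s%:Z = Num.ceil (p%:R / 2 : R)]).
Proof.
split=> [n n3|p q p1 pq].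
  have n1 : (1 <= n)%N by lia.
  have [s [cs smin] sK] := spherical_cover_number_exists (coverable_complete R n1).
  exists s; split=> //.
  have cG : #|complete_graph n| = n.-1.+1 by rewrite card_ord; lia.
  have := coverable_edges cG _ (or_introl (erefl 3%N)) cs; rewrite (_ : 1 < n.-1)%N; last by lia.
  move=> /(_ isT) E; have E2 := card_edges_complete n.
  (* The bound reads [n (n - 1) <= 6 s (n - 2)], while [n (n - 1) = (n + 1) (n - 2) + 2]. *)
  have H : (n + 1 < 6 * s)%N by nia.
  apply/andP; split.
    have h : (n + 1)%:R < (6 * s)%:R :> R by rewrite ltr_nat.
    rewrite natrD natrM in h.
    by rewrite -ltzD1 floor_lt_int ltr_pdivrMr // intrD -!pmulrn; lra.
  have h : (s * 4)%:R < (n + 4)%:R :> R by rewrite ltr_nat; lia.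
  rewrite natrD natrM in h.
  have : s%:Z - 1 < Num.ceil (n%:R / 4 : R).
    by rewrite ceil_gt_int ltr_pdivlMr // intrB -!pmulrn; lra.
  lia.
have [s [cs smin] sK] := spherical_cover_number_exists (coverable_bipartite R q p1).
have v0 : complete_bipartite_graph p q by left; exact: (Ordinal p1).
have s0 := coverable_gt0 v0 cs.
have bound : (3 <= p + q)%N -> (p * q <= s * (2 * (p + q - 2)))%N.
  move=> pq3; have cG : #|complete_bipartite_graph p q| = (p + q).-1.+1.
    by rewrite card_sum !card_ord; lia.
  have girth : even_girth (complete_bipartite_graph p q) 4.
    by right; split=> //; exists (@Defs.is_left p q) => u v.
  have := coverable_edges cG _ girth cs; rewrite (_ : 1 < (p + q).-1)%N; last by lia.
  move=> /(_ isT) E; have E2 := card_edges_bipartite p q; nia.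
exists s; split=> //; last 2 first.
- by lia.
- move=> qp; have E : s = uphalf p.
    apply/eqP; rewrite eqn_leq sK /=; have [p1'|p2] := leqP p 1; first by lia.
    have := bound _; rewrite (_ : 2 < p + q)%N; last by lia.
    move=> /(_ isT) B; rewrite leqNgt; apply/negP => sp.
    (* Then [p q <= (p - 1) (p + q - 2)], which gives [q <= (p - 1) (p - 2)] against [qp]. *)
    have s2 : (2 * s + 1 <= p)%N by lia.
    nia.
  apply/eqP; rewrite eq_le; apply/andP; split.
    have h : (s * 2)%:R < (p + 2)%:R :> R by rewrite ltr_nat; lia.
    rewrite natrD natrM in h.
    have : s%:Z - 1 < Num.ceil (p%:R / 2 : R).
      by rewrite ceil_gt_int ltr_pdivlMr // intrB -!pmulrn; lra.
    lia.
  by rewrite ceil_le_int ler_pdivrMr // -pmulrn -natrM ler_nat; lia.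
move=> pq11; have pq3 : (3 <= p + q)%N.
  have [//|] := leqP 3 (p + q) => h; case: pq11; congr pair; lia.
have B := bound pq3.
have d : 2 * p%:R + 2 * q%:R - 4 = (2 * (p + q - 2))%:R :> R.
  by rewrite natrM natrB ?natrD; [ring | lia].
rewrite d ler_pdivrMr; first by rewrite -!natrM ler_nat.
by rewrite ltr0n; lia.
Qed.
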